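(* Consider a continuous-time multi-agent system of $N$ identical agents $\dot x_i=Ax_i+Bu_i$, $y_i=Cx_i$ ($i=1,\dots,N$), with $x_i\in\mathbb{R}^n$, $u_i\in\mathbb{R}$, $y_i\in\mathbb{R}$. Each agent receives $\zeta_i=\sum_{j=1}^N\ell_{ij}y_j$ and $\hat\zeta_i=\sum_{j=1}^N\ell_{ij}H_cx_{j,c}$, and uses a collaborative linear protocol $$\dot x_{i,c}=A_cx_{i,c}+B_c\zeta_i+E_c\hat\zeta_i,\qquad u_i=F_cx_{i,c}+G^1_c\zeta_i+G^2_c\hat\zeta_i,$$ with $x_{i,c}\in\mathbb{R}^{n_c}$. The scale-free collaborative state synchronization problem asks for fixed matrices $A_c,B_c,E_c,F_c,G_c^1,G_c^2,H_c$ (independent of $N$ and of the graph) such that for every number of agents $N$, every weighted directed graph on $N$ nodes containing a directed spanning tree, and all initial conditions of agents and protocols, $\lim_{t\to\infty}(x_i(t)-x_j(t))=0$ for all $i,j$. This problem is solvable if and only if either $A$ is asymptotically stable (Hurwitz), or all of the following hold: $(A,B)$ is stabilizable, $(C,A)$ is detectable, and all eigenvalues of $A$ lie in the closed left-half complex plane.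
   Context: The network is described by a weighted directed graph on nodes $\{1,\dots,N\}$ with weighted adjacency matrix $[a_{ij}]$, $a_{ij}\ge0$, $a_{ii}=0$, where $a_{ij}>0$ means an edge from node $j$ to node $i$. The Laplacian $L=[\ell_{ij}]$ has $\ell_{ii}=\sum_k a_{ik}$ and $\ell_{ij}=-a_{ij}$ for $i\neq j$. A directed spanning tree exists iff some node has a directed path to every other node. *)

(* Defs.v *)
From HB Require Import structures.
From mathcomp Require Import all_boot all_order all_algebra.
From mathcomp Require Import complex.
From mathcomp Require Import all_classical all_reals all_analysis.
Set Implicit Arguments. Unset Strict Implicit. Unset Printing Implicit Defensive.
Import Order.TTheory GRing.Theory Num.Theory.
Import numFieldNormedType.Exports.
Local Open Scope classical_set_scope.
Local Open Scope ring_scope.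

Section Defs.
Variable R : realType.

Definition cmx n (A : 'M[R]_n) : 'M[R[i]]_n := map_mx (fun r => (r%:C)%C) A.

Definition hurwitz n (A : 'M[R]_n) : Prop :=
  forall z : R[i], eigenvalue (cmx A) z -> complex.Re z < 0.

Definition eig_closed_lhp n (A : 'M[R]_n) : Prop :=
  forall z : R[i], eigenvalue (cmx A) z -> complex.Re z <= 0.

Definition stabilizable n m (A : 'M[R]_n) (B : 'M[R]_(n, m)) : Prop :=
  exists F : 'M[R]_(m, n), hurwitz (A + B *m F).

Definition detectable n p (C : 'M[R]_(p, n)) (A : 'M[R]_n) : Prop :=
  exists K : 'M[R]_(n, p), hurwitz (A + K *m C).

(* weighted adjacency matrix: a i j >= 0 (edge j -> i iff a i j > 0), a i i = 0 *)
Definition adjacency N (a : 'M[R]_N) : Prop :=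
  (forall i j, 0 <= a i j) /\ (forall i, a i i = 0).

Definition laplacian N (a : 'M[R]_N) : 'M[R]_N :=
  \matrix_(i, j) (if i == j then \sum_(k < N) a i k else - a i j).

Definition edge N (a : 'M[R]_N) : rel 'I_N := fun u v => 0 < a v u.

Definition has_spanning_tree N (a : 'M[R]_N) : Prop :=
  exists r : 'I_N, forall i : 'I_N, connect (edge a) r i.

Definition has_deriv p q (f : R -> 'M[R]_(p, q)) (df : R -> 'M[R]_(p, q)) : Prop :=
  forall t (k : 'I_p) (l : 'I_q), is_derive t (1 : R) (fun s => f s k l) (df t k l).

Definition tends_to_zero p q (g : R -> 'M[R]_(p, q)) : Prop :=
  forall (k : 'I_p) (l : 'I_q), (fun t => g t k l) @ +oo --> (0 : R).

Definition closed_loop n nc q (A : 'M[R]_n) (B : 'M[R]_(n, 1)) (C : 'M[R]_(1, n))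
  (Ac : 'M[R]_nc) (Bc : 'M[R]_(nc, 1)) (Ec : 'M[R]_(nc, q)) (Fc : 'M[R]_(1, nc))
  (G1 : 'M[R]_1) (G2 : 'M[R]_(1, q)) (Hc : 'M[R]_(q, nc))
  N (a : 'M[R]_N) (x : 'I_N -> R -> 'cV[R]_n) (xc : 'I_N -> R -> 'cV[R]_nc) : Prop :=
  let L := laplacian a in
  let zeta i t : 'M[R]_1 := \sum_(j < N) L i j *: (C *m x j t) in
  let zetah i t : 'cV[R]_q := \sum_(j < N) L i j *: (Hc *m xc j t) in
  let u i t : 'M[R]_1 := Fc *m xc i t + G1 *m zeta i t + G2 *m zetah i t in
  forall i : 'I_N,
    has_deriv (x i) (fun t => A *m x i t + B *m u i t) /\
    has_deriv (xc i) (fun t => Ac *m xc i t + Bc *m zeta i t + Ec *m zetah i t).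

End Defs.

(* Main.v *)
(* Sufficiency.  If [A + B F] and [A + K C] are Hurwitz, let the protocol state be
   a pair (xh, chi) with u_i = F chi_i, where xh_i observes sum_j l_ij x_j and
   chi_i' = (A + B F) chi_i + xh_i - sum_j l_ij chi_j.  Then
   sum_j l_ij x_j - xh_i decays through [A + K C], and e_i = x_i - chi_i satisfies
   e_i' = A e_i - sum_j l_ij e_j + o(1).  Apart from a simple eigenvalue 0 with
   constant eigenvector, the Laplacian has its spectrum in Re > 0 (maximum
   principle and Gershgorin), so e_i - e_j -> 0, hence x_i - x_j -> 0.

   Necessity.  A leader at rest followed by one agent with weight w gives a linear
   system with matrix M(w) = M0 + w M1 whose upper block of coordinates [H] decays.
   Splitting off the unstable roots of its characteristic polynomial gives
   H s(M(w)) = 0 for a product s of factors X - z with Re z < 0.  The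
   Popov-Belevitch-Hautus conditions follow at once, and imply the existence of
   gains by moving unstable eigenvalues one conjugate pair at a time.  Letting w
   tend to 0 rules out eigenvalues of [A] with positive real part. *)

Require Import Defs.
From HB Require Import structures.
From mathcomp Require Import all_boot all_order all_algebra.
From mathcomp Require Import complex ring lra.
From mathcomp Require Import all_classical all_reals all_analysis.
Import Order.TTheory GRing.Theory Num.Theory.
Import numFieldNormedType.Exports.
Local Open Scope classical_set_scope.
Local Open Scope ring_scope.

Set Implicit Arguments.
Unset Strict Implicit.
Unset Printing Implicit Defensive.

(** * Products of linear factors of a matrix *)

Section SplitMatrix.
Context {F : fieldType}.

(** A fold over the list of roots, rather than [horner_mx] of a polynomial, also makes sense in size
    0 and lets inductions peel off one factor at a time. *)
Definition mxprod {m : nat} (M : 'M[F]_m) (zs : seq F) : 'M[F]_m :=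
  foldr (fun z P => (M - z%:M) *m P) 1%:M zs.

Lemma mxprod_cat m (M : 'M[F]_m) s t :
  mxprod M (s ++ t) = mxprod M s *m mxprod M t.
Proof.
by elim: s => [|z s IH] /=; [rewrite mul1mx | rewrite IH mulmxA].
Qed.

Lemma mxprod_horner m (M : 'M[F]_m.+1) zs :
  mxprod M zs = horner_mx M (\prod_(z <- zs) ('X - z%:P)).
Proof.
elim: zs => [|z zs IH] /=; first by rewrite big_nil [RHS]rmorph1.
by rewrite big_cons rmorphM /= rmorphB /= horner_mx_X horner_mx_C IH.
Qed.

Lemma mxprod_perm m (M : 'M[F]_m) s t : perm_eq s t -> mxprod M s = mxprod M t.
Proof.
case: m M => [|m] M st; first by rewrite [LHS]flatmx0 [RHS]flatmx0.
by rewrite !mxprod_horner (perm_big _ st).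
Qed.

Lemma mxprodC m (M : 'M[F]_m) zs :
  M *m mxprod M zs = mxprod M zs *m M.
Proof.
elim: zs => [|z zs IH] /=; first by rewrite mul1mx mulmx1.
by rewrite -[RHS]mulmxA -IH !mulmxA mulmxBr [in RHS]mulmxBl scalar_mxC.
Qed.

Lemma mxprod_eig_col m (M : 'M[F]_m) zs z p (v : 'M[F]_(m, p)) :
  M *m v = z *: v -> mxprod M zs *m v = (\prod_(w <- zs) (z - w)) *: v.
Proof.
move=> Mv; elim: zs => [|w zs IH] /=; first by rewrite big_nil mul1mx scale1r.
rewrite -mulmxA IH -scalemxAr mulmxBl Mv mul_scalar_mx -scalerBl scalerA.
by rewrite big_cons mulrC.
Qed.

Lemma mxprod_eig_row m (M : 'M[F]_m) zs z p (r : 'M[F]_(p, m)) :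
  r *m M = z *: r -> r *m mxprod M zs = (\prod_(w <- zs) (z - w)) *: r.
Proof.
move=> rM; elim: zs => [|w zs IH] /=; first by rewrite big_nil mulmx1 scale1r.
rewrite mulmxA mulmxBr rM mul_mx_scalar -scalerBl -scalemxAl IH scalerA.
by rewrite big_cons.
Qed.

Lemma mxprod_char m (M : 'M[F]_m) zs :
  char_poly M = \prod_(z <- zs) ('X - z%:P) -> mxprod M zs = 0.
Proof.
case: m M => [|m] M ch; first by rewrite [LHS]flatmx0.
by rewrite mxprod_horner -ch Cayley_Hamilton.
Qed.

End SplitMatrix.

Lemma char_poly_roots {F : closedFieldType} m (M : 'M[F]_m) :
  exists zs, [/\ char_poly M = \prod_(z <- zs) ('X - z%:P), size zs = m
             & forall z, eigenvalue M z = (z \in zs)].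
Proof.
have [zs] := closed_field_poly_normal (char_poly M).
rewrite (monicP (char_poly_monic M)) scale1r => ch; exists zs; split => //.
  by have := size_char_poly M; rewrite ch size_prod_XsubC => -[].
by move=> z; rewrite eigenvalue_root_char ch root_prod_XsubC.
Qed.

Lemma eigenvalue_tr {F : fieldType} m (M : 'M[F]_m) z :
  eigenvalue M^T z = eigenvalue M z.
Proof.
rewrite !eigenvalue_root_char; congr (root _ z); rewrite /char_poly -det_tr.
by congr (\det _); apply/matrixP => i j; rewrite !mxE eq_sym.
Qed.

(* Both sides come from the block matrix [[P, b], [g, 1]]; cancelling powers of
   [\det P] needs it to be nonzero, not invertible. *)
Lemma det_sub_rank1 (D : idomainType) m (P : 'M[D]_m) (b : 'cV_m) (g : 'rV_m) :
  \det P != 0 -> \det (P - b *m g) = \det P - (g *m \adj P *m b) 0 0.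
Proof.
move=> P0; set N := block_mx P b g (1%:M : 'M[D]_1).
have N1 : \det N = \det (P - b *m g).
  have : \det (N *m block_mx 1%:M 0 (- g) 1%:M) = \det (P - b *m g).
    rewrite mulmx_block !mulmx1 !mulmx0 !add0r mulmxN mul1mx subrr.
    by rewrite det_ublock det1 mulr1.
  by rewrite det_mulmx det_lblock !det1 !mulr1.
have : \det (N *m block_mx (\adj P) (- (\adj P *m b)) 0 (\det P)%:M) =
    \det P ^+ m * (\det P - (g *m \adj P *m b) 0 0).
  rewrite mulmx_block !mulmx0 !addr0 !mulmxN !mulmxA mul_mx_adj mul1mx.
  rewrite mul_mx_scalar mul_scalar_mx addNr det_lblock det_scalar; congr (_ * _).
  by rewrite det_mx11 !mxE eqxx mulr1n addrC.
rewrite det_mulmx det_ublock det_scalar1 N1 [\det (\adj P) * _]mulrC -det_mulmx.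
rewrite mul_mx_adj det_scalar mulrC => /mulfI; apply.
by rewrite expf_neq0.
Qed.

(** A left eigenvector [r] of [A] satisfies ('X - z) r adj('X - A) = char_poly A r, which makes the
    correction term of [det_sub_rank1] explicit. Multiplying by both linear factors keeps the
    identity among polynomials. *)
Lemma char_poly_rank1_update {F : fieldType} m (A : 'M[F]_m) (b : 'cV_m)
    (r1 r2 : 'rV_m) z1 z2 :
  r1 *m A = z1 *: r1 -> r2 *m A = z2 *: r2 ->
  ('X - z1%:P) * ('X - z2%:P) * char_poly (A + b *m (r1 + r2)) =
  char_poly A * (('X - z1%:P) * ('X - z2%:P)
     - ((r1 *m b) 0 0)%:P * ('X - z2%:P) - ((r2 *m b) 0 0)%:P * ('X - z1%:P)).
Proof.
move=> r1A r2A; pose P := char_poly_mx A; pose pC p q := @map_mx _ _ (@polyC F) p q.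
have detP : \det P != 0 by apply: monic_neq0 (char_poly_monic A).
have rP (r : 'rV_m) z : r *m A = z *: r ->
    ('X - z%:P) *: (pC _ _ r *m \adj P) = char_poly A *: pC _ _ r.
  move=> rA; have rPz : pC _ _ r *m P = ('X - z%:P) *: pC _ _ r.
    rewrite /P /char_poly_mx mulmxBr /pC -map_mxM rA mul_mx_scalar scalerBl.
    by congr (_ - _); apply/matrixP => i j; rewrite !mxE /= polyCM.
  by rewrite scalemxAl -rPz -mulmxA mul_mx_adj mul_mx_scalar.
have rPb (r : 'rV_m) z : r *m A = z *: r ->
    ('X - z%:P) * (pC _ _ r *m \adj P *m pC _ _ b) 0 0 =
    char_poly A * ((r *m b) 0 0)%:P.
  move=> rA; have := congr1 (fun Z => (Z *m pC _ _ b) 0 0) (rP r z rA).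
  by rewrite -!scalemxAl [LHS]mxE [RHS]mxE => ->; rewrite /pC -map_mxM mxE.
have -> : char_poly (A + b *m (r1 + r2)) =
    \det (P - pC _ _ b *m (pC _ _ r1 + pC _ _ r2)).
  congr (\det _); rewrite /P /char_poly_mx /pC map_mxD map_mxM map_mxD.
  by rewrite opprD addrA.
rewrite det_sub_rank1 // !mulmxDl mxE -/(char_poly A).
have E1 := rPb _ _ r1A; have E2 := rPb _ _ r2A.
set x1 := (pC _ _ r1 *m _ *m _) 0 0 in E1 *.
set x2 := (pC _ _ r2 *m _ *m _) 0 0 in E2 *.
transitivity (('X - z1%:P) * ('X - z2%:P) * char_poly A
  - ('X - z2%:P) * (('X - z1%:P) * x1) - ('X - z1%:P) * (('X - z2%:P) * x2)).
  by ring.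
by rewrite E1 E2; ring.
Qed.

(** * Stabilization by eigenvalue shifting *)

Notation mxC := (map_mx (real_complex _)).

Section PoleShifting.
Variable R : realType.
Local Notation C := R[i].
Local Notation Re := (@complex.Re R).
Local Notation Im := (@complex.Im R).

Lemma mxC_conj m n (M : 'M[R]_(m, n)) : map_mx conjc (mxC M) = mxC M.
Proof. by apply/matrixP => i j; rewrite !mxE conjc_real. Qed.

Lemma mxC_realpart m n (M : 'M[C]_(m, n)) :
  mxC (map_mx (fun x => Re x + Re x) M) = M + map_mx conjc M.
Proof.
apply/matrixP => i j; rewrite !mxE; case: (M i j) => a b /=.
by apply/eqP; rewrite eq_complex /= subrr !eqxx.
Qed.

(* [b] is the value of [r B] for a suitable multiple [r] of a left eigenvector
   of [z]; the pair [z, conj z] is moved to [-1, p]. *)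
Lemma shift_pair (z : C) : exists b p : C, (p = -1 \/ p = z) /\
  ('X - z%:P) * ('X - (conjc z)%:P) - b%:P * ('X - (conjc z)%:P)
    - (conjc b)%:P * ('X - z%:P) = ('X - (-1)%:P) * ('X - p%:P).
Proof.
have key (b p : C) : z + conjc z + b + conjc b = p - 1 ->
    z * conjc z + b * conjc z + conjc b * z = - p ->
    ('X - z%:P) * ('X - (conjc z)%:P) - b%:P * ('X - (conjc z)%:P)
      - (conjc b)%:P * ('X - z%:P) = ('X - (-1)%:P) * ('X - p%:P).
  move=> E1 E2.
  transitivity ('X ^+ 2 - (z + conjc z + b + conjc b)%:P * 'X +
      (z * conjc z + b * conjc z + conjc b * z)%:P).
    by rewrite !(polyCD, polyCM); ring.
  by rewrite E1 E2 !(polyCB, polyCN) polyC1; ring.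
case: z key => x y key; have [y0|y0] := eqVneq y 0.
  exists (Complex (- (x + 1) / 2) 0), (Complex x 0).
  rewrite y0 in key *; split; first by right.
  by apply: key; apply/eqP; rewrite eq_complex /=;
     apply/andP; split; apply/eqP; field.
(* With p = -1, comparing the sums of the roots fixes Re b, and comparing their products is then
   linear in Im b with coefficient 2y. This is why real [z] is treated apart. *)
pose b1 := - 1 - x; pose b2 := (1 - x ^+ 2 - y ^+ 2 - 2 * x * b1) / (2 * y).
exists (Complex b1 b2), (-1); split; first by left.
have b2E : 2 * y * b2 = 1 - x ^+ 2 - y ^+ 2 - 2 * x * b1.
  by rewrite mulrC divfK // mulf_neq0 // pnatr_eq0.
apply: key; apply/eqP; rewrite eq_complex /=; apply/andP; split; apply/eqP;
  try by rewrite /b1; ring.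
transitivity (x ^+ 2 + y ^+ 2 + 2 * x * b1 + 2 * y * b2); first by ring.
by rewrite b2E; ring.
Qed.

(** The Hautus test in eigenvector form: [A - z, B] has full row rank for every z in the closed
    right half-plane. *)
Definition pbh_stabilizable n m (A : 'M[R]_n) (B : 'M[R]_(n, m)) : Prop :=
  forall (z : C) (r : 'rV[C]_n), 0 <= Re z ->
    r *m cmx A = z *: r -> r *m mxC B = 0 -> r = 0.

(** Induction on the number of unstable eigenvalues, counted with multiplicity. A real rank-one
    feedback built from a left eigenvector and its conjugate removes at least one of them, and the
    Hautus test is invariant under feedback. *)
Lemma stabilizable_of_pbh n (A : 'M[R]_n) (B : 'cV[R]_n) :
  pbh_stabilizable A B -> stabilizable A B.
Proof.
pose unst := fun z : C => 0 <= Re z.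
suff main k : forall A : 'M[R]_n, pbh_stabilizable A B -> forall zs,
    char_poly (cmx A) = \prod_(z <- zs) ('X - z%:P) ->
    (count unst zs <= k)%N -> stabilizable A B.
  by have [zs [ch _ _]] := char_poly_roots (cmx A) => pbh; apply: (main _ A pbh _ ch).
elim: k => [|k IH] {}A pbh zs ch.
  rewrite leqn0 => /eqP c0; exists 0; rewrite mulmx0 addr0 => z.
  rewrite eigenvalue_root_char ch root_prod_XsubC => zzs.
  rewrite ltNge; apply/negP => z0; suff : has unst zs by rewrite has_count c0.
  by apply/hasP; exists z.
move=> ck; have [/hasP[z zzs z0]|] := boolP (has unst zs); last first.
  by rewrite has_count -leqNgt => c0; apply: (IH A pbh _ ch); apply: leq_trans c0 _.
have /eigenvalueP[r rA r0] : eigenvalue (cmx A) z.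
  by rewrite eigenvalue_root_char ch root_prod_XsubC.
pose b := (r *m mxC B) 0 0.
have b0 : b != 0.
  apply: contra r0 => /eqP b0; apply/eqP; apply: (pbh z) => //.
  by rewrite [LHS]mx11_scalar -/b b0 raddf0.
have [be [p [pE qE]]] := shift_pair z.
(* The scaling makes [s B] equal to the value [be] requested by [shift_pair]; the test guarantees
   [b != 0]. *)
pose s := (be / b) *: r.
have sA : s *m cmx A = z *: s by rewrite -scalemxAl rA !scalerA mulrC.
have sB : (s *m mxC B) 0 0 = be by rewrite -scalemxAl mxE -/b divfK.
have sJA : map_mx conjc s *m cmx A = conjc z *: map_mx conjc s.
  by rewrite [cmx A](esym (mxC_conj A)) -map_mxM -/(cmx A) sA map_mxZ.
have sJB : (map_mx conjc s *m mxC B) 0 0 = conjc be.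
  by rewrite -(mxC_conj B) -map_mxM mxE sB.
pose F0 := map_mx (fun x => Re x + Re x) s.
have A1E : cmx (A + B *m F0) = cmx A + mxC B *m (s + map_mx conjc s).
  by rewrite -mxC_realpart -map_mxM -map_mxD.
have pbh1 : pbh_stabilizable (A + B *m F0) B.
  move=> w t w0; rewrite /cmx map_mxD map_mxM mulmxDr mulmxA => tA tB.
  by apply: (pbh w t w0) => //; rewrite tB mul0mx addr0 in tA.
have [zs1 [ch1 _ _]] := char_poly_roots (cmx (A + B *m F0)).
have := char_poly_rank1_update (mxC B) sA sJA.
rewrite -A1E ch1 ch sB sJB qE => eqp.
(* Comparing multisets of roots, with [z] and its conjugate added on one side, covers real and
   nonreal [z] together: for real [z] the root [p = z] compensates the second copy. *)
have /(permP)/(_ unst) : perm_eq [:: z, conjc z & zs1] [:: -1, p & zs].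
  by apply: prod_XsubC_eq; rewrite !big_cons mulrA eqp; ring.
have uz : unst z = true by [].
have uzJ : unst (conjc z) = true by move: z0; case: (z).
have u1 : unst (-1) = false by rewrite /unst /= oppr_ge0 real_leNgt ?ltr01.
rewrite /= uz uzJ u1 /= !add0n add1n add1n => eqc.
have c1 : (count unst zs1 <= k)%N.
  rewrite -ltnS; apply: leq_trans ck; rewrite -ltnS eqc.
  by case: pE => ->; rewrite ?u1 ?uz //= add0n.
have [F1 hF1] := IH _ pbh1 _ ch1 c1.
by exists (F0 + F1); rewrite mulmxDr addrA.
Qed.

Lemma detectable_of_stabilizable_tr n p (C0 : 'M[R]_(p, n)) (A : 'M[R]_n) :
  stabilizable A^T C0^T -> detectable C0 A.
Proof.
move=> [F hF]; exists F^T => z; rewrite -eigenvalue_tr => zE; apply: hF.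
suff -> : cmx (A^T + C0^T *m F) = (cmx (A + F^T *m C0))^T by [].
by rewrite /cmx [RHS]map_trmx [(_ + _)^T]linearD /= trmx_mul trmxK.
Qed.

End PoleShifting.

(** * Decay for linear differential equations *)

Section ComplexDecay.
Variable R : realType.
Local Notation C := R[i].
Local Notation Re := (@complex.Re R).
Local Notation Im := (@complex.Im R).

Lemma derive_nincr (h dh : R -> R) (T : R) :
  (forall t, is_derive t (1 : R) h (dh t)) -> (forall t, T < t -> dh t <= 0) ->
  forall t, T <= t -> h t <= h T.
Proof.
move=> hd dle t Tt.
have dv x : derivable h x 1 by have [] := hd x.
apply: (@ler0_derive1_nincry _ h T) => // [x|].
  rewrite in_itv /= andbT => Tx; rewrite derive1E.
  by have [_ ->] := hd x; exact: dle.
by apply: derivable_within_continuous => x _.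
Qed.

Lemma derive_ndecr (h dh : R -> R) (T : R) :
  (forall t, is_derive t (1 : R) h (dh t)) -> (forall t, 0 <= dh t) ->
  forall t, T <= t -> h T <= h t.
Proof.
move=> hd dge t Tt.
rewrite -lerN2; apply: (@derive_nincr (fun t => - h t) (fun t => - dh t)) => //.
by move=> s _; rewrite oppr_le0.
Qed.

(** Once g <= c e / 2, the function exp(c t) (h - e / 2) is nonincreasing, so h exceeds e / 2 by at
    most a multiple of exp(- c t). *)
Lemma differential_inequality_decay (c : R) (h dh g : R -> R) : 0 < c ->
  (forall t, is_derive t (1 : R) h (dh t)) ->
  (forall t, dh t <= - c * h t + g t) -> (forall t, 0 <= h t) ->
  g @ +oo --> (0 : R) -> h @ +oo --> (0 : R).
Proof.
move=> c0 hd dle h0 /cvgrPdist_le g0; apply/cvgrPdist_le => e e0.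
have [|M [_ HM]] := g0 (c * (e / 2)); first by rewrite mulr_gt0 // divr_gt0.
pose T := M + 1.
pose k t := expR (c * t) * (h t - e / 2).
have kd t : is_derive t (1 : R) k
    (expR (c * t) * (c * (h t - e / 2) + dh t)).
  have E : is_derive t (1 : R) (fun t => expR (c * t)) (c * expR (c * t)).
    apply: trigger_derive; rewrite /GRing.scale /= ?mulr1 ?mulr0 ?addr0.
    by ring.
  apply: trigger_derive; rewrite /GRing.scale /=.
  by ring.
have kle t : T <= t -> k t <= k T.
  apply: (derive_nincr kd) => s Ts; rewrite pmulr_rle0 ?expR_gt0 //.
  have /HM : M < s by apply: lt_trans Ts; rewrite ltrDl.
  rewrite sub0r normrN => /ler_normlP[_ gs].
  have := dle s; rewrite mulrBr mulNr; lra.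
near=> t; rewrite sub0r normrN ger0_norm //.
have ee : 0 < expR (c * t) by exact: expR_gt0.
have Tt : T <= t by near: t; apply: nbhs_pinfty_ge; rewrite num_real.
have KT : k T <= e / 2 * expR (c * t).
  apply: le_trans (ler_norm _) _.
  (* For such [t] the linear bound exp(c t) >= 1 + c t already absorbs the constant [k T]. *)
  have : 2 * `|k T| / (c * e) <= t.
    by near: t; apply: nbhs_pinfty_ge; rewrite num_real.
  rewrite ler_pdivrMr ?mulr_gt0 // => Kt.
  have := expR_ge1Dx (c * t); rewrite -(ler_pM2l e0) => et.
  have := le_trans Kt; nra.
have := le_trans (kle _ Tt) KT; rewrite /k mulrC ler_pM2r //; lra.
Unshelve. all: by end_near. Qed.

(** Differentiation by real and imaginary parts keeps all the calculus over [R], while eigenvalues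
    may be complex. *)
Definition has_cderiv (f df : R -> C) : Prop := forall t,
  is_derive t (1 : R) (fun s => Re (f s)) (Re (df t)) /\
  is_derive t (1 : R) (fun s => Im (f s)) (Im (df t)).

Definition ctends0 (f : R -> C) : Prop :=
  (fun t => Re (f t)) @ +oo --> (0 : R) /\ (fun t => Im (f t)) @ +oo --> (0 : R).

Lemma sqr_modulus_derive (z : C) (f g : R -> C) :
  has_cderiv f (fun t => z * f t + g t) -> forall t,
  is_derive t (1 : R) (fun s => Re (f s) ^+ 2 + Im (f s) ^+ 2)
    (2 * Re z * (Re (f t) ^+ 2 + Im (f t) ^+ 2)
       + 2 * (Re (f t) * Re (g t) + Im (f t) * Im (g t))).
Proof.
move=> fd t; have [dr di] := fd t.
apply: trigger_derive; rewrite /GRing.scale /=.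
by case: z (f t) (g t) {dr di fd} => a b [u v] [p q] /=; ring.
Qed.

(** With c = - Re z, the squared modulus h of f satisfies h' <= - c h + |g|^2 / c, so the scalar
    inequality applies. *)
Lemma cderiv_decay (z : C) (f g : R -> C) : Re z < 0 ->
  has_cderiv f (fun t => z * f t + g t) -> ctends0 g -> ctends0 f.
Proof.
move=> z0 fd [gr gi]; pose c := - Re z; have c0 : 0 < c by rewrite oppr_gt0.
pose h t := Re (f t) ^+ 2 + Im (f t) ^+ 2.
have h0 t : 0 <= h t by rewrite addr_ge0 ?sqr_ge0.
have hlim : h @ +oo --> (0 : R).
  apply: (differential_inequality_decay c0 (sqr_modulus_derive fd) (g := fun t =>
    c^-1 * (Re (g t) * Re (g t) + Im (g t) * Im (g t)))) => // [t|].
    (* AM-GM: [2 u p <= c u^2 + p^2 / c] in both components. *)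
    have amgm (u p : R) : 2 * (u * p) <= c * u ^+ 2 + c^-1 * (p * p).
      rewrite -subr_ge0; suff -> : c * u ^+ 2 + c^-1 * (p * p) - 2 * (u * p) =
        c^-1 * (c * u - p) ^+ 2 by rewrite mulr_ge0 ?sqr_ge0 // invr_ge0 ltW.
      by field; rewrite gt_eqF.
    have := amgm (Re (f t)) (Re (g t)); have := amgm (Im (f t)) (Im (g t)).
    have -> : Re z = - c by rewrite opprK.
    by rewrite mulrDr [c^-1 * (_ + _)]mulrDr; lra.
  rewrite -[X in _ --> X](_ : c^-1 * (0 * 0 + 0 * 0) = 0); last by rewrite !mul0r addr0 mulr0.
  by apply: cvgMr; apply: cvgD; apply: cvgM.
have sq (u : R -> R) : (forall t, u t ^+ 2 <= h t) -> u @ +oo --> (0 : R).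
  move=> uh; apply/cvgrPdist_lt => e e0.
  move/cvgrPdist_lt : hlim => /(_ (e ^+ 2)); rewrite exprn_gt0 // => /(_ isT).
  apply: filterS => t; rewrite !sub0r !normrN (ger0_norm (h0 t)) => he.
  rewrite -(@ltr_pXn2r _ 2) ?nnegrE ?(ltW e0) //.
  by rewrite real_normK ?num_real //; apply: le_lt_trans he.
by split; apply: sq => t; rewrite /h ?lerDl ?lerDr sqr_ge0.
Qed.

(** The squared modulus is nondecreasing and tends to 0, hence is at most 0 at time 0. *)
Lemma cderiv_unstable (z : C) (f : R -> C) : 0 <= Re z ->
  has_cderiv f (fun t => z * f t) -> ctends0 f -> f 0 = 0.
Proof.
move=> z0 fd [fr fi].
have fd' : has_cderiv f (fun t => z * f t + 0).
  by move=> t; rewrite addr0; exact: fd.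
have hd := sqr_modulus_derive fd'.
have : Re (f 0) ^+ 2 + Im (f 0) ^+ 2 <= 0.
  have lim : (fun t => Re (f t) * Re (f t) + Im (f t) * Im (f t)) @ +oo --> (0 : R).
    rewrite -[X in _ --> X](_ : 0 * 0 + 0 * 0 = 0); last by rewrite !mul0r addr0.
    by apply: cvgD; apply: cvgM.
  rewrite leNgt; apply/negP => p0.
  have /cvgrPdist_lt/(_ _ p0) [M [_ HM]] := lim.
  have := HM (Num.max M 0 + 1); rewrite ltr_pwDr ?le_max ?lexx // => /(_ isT).
  rewrite sub0r normrN ltNge => /negP; apply.
  apply: le_trans (ler_norm _); rewrite -!expr2.
  apply: (derive_ndecr hd) => [t|]; last by rewrite addr_ge0 // le_max lexx orbT.
  rewrite /= !mulr0 addr0 mulr0 addr0 mulr_ge0 //; first by rewrite mulr_ge0.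
  by rewrite addr_ge0 ?sqr_ge0.
case: (f 0) => a b /= ab; apply/eqP; rewrite eq_complex /=.
have := sqr_ge0 a; have := sqr_ge0 b => b0 a0.
have a2 : a ^+ 2 = 0 by lra.
have b2 : b ^+ 2 = 0 by lra.
by rewrite -(sqrf_eq0 a) -(sqrf_eq0 b) a2 b2 !eqxx.
Qed.

End ComplexDecay.

(** * Decay of matrix-valued trajectories *)

Section MatrixDecay.
Variable R : realType.
Local Notation C := R[i].
Local Notation Re := (@complex.Re R).
Local Notation Im := (@complex.Im R).

Lemma ReD (x y : C) : Re (x + y) = Re x + Re y.
Proof. by case: x; case: y. Qed.

Lemma ImD (x y : C) : Im (x + y) = Im x + Im y.
Proof. by case: x; case: y. Qed.

Lemma ReM (x y : C) : Re (x * y) = Re x * Re y - Im x * Im y.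
Proof. by case: x; case: y. Qed.

Lemma ImM (x y : C) : Im (x * y) = Re x * Im y + Im x * Re y.
Proof. by case: x; case: y. Qed.

Lemma cvg0_ext (f g : R -> R) :
  f =1 g -> g @ +oo --> (0 : R) -> f @ +oo --> (0 : R).
Proof. by move=> /funext ->. Qed.

Lemma eq_has_cderiv (f f' df df' : R -> C) : f =1 f' -> df =1 df' ->
  has_cderiv f' df' -> has_cderiv f df.
Proof. by move=> /funext -> /funext ->. Qed.

Lemma eq_ctends0 (f f' : R -> C) : f =1 f' -> ctends0 f' -> ctends0 f.
Proof. by move=> /funext ->. Qed.

Lemma has_cderiv_const (c : C) : has_cderiv (fun=> c) (fun=> 0).
Proof. by move=> t; split; exact: is_derive_cst. Qed.

Lemma has_cderivD (f df g dg : R -> C) : has_cderiv f df -> has_cderiv g dg ->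
  has_cderiv (fun t => f t + g t) (fun t => df t + dg t).
Proof.
move=> fd gd t; have [fr fi] := fd t; have [gr gi] := gd t.
split; rewrite ?ReD ?ImD; [under eq_fun do rewrite ReD | under eq_fun do rewrite ImD];
  exact: is_deriveD.
Qed.

Lemma has_cderivMl (c : C) (f df : R -> C) : has_cderiv f df ->
  has_cderiv (fun t => c * f t) (fun t => c * df t).
Proof.
move=> fd t; have [fr fi] := fd t.
split; rewrite ?ReM ?ImM; [under eq_fun do rewrite ReM | under eq_fun do rewrite ImM];
  by apply: trigger_derive; rewrite /GRing.scale /=; ring.
Qed.

Lemma ctends0_const0 : ctends0 (fun=> 0 : C).
Proof. by split; exact: cvg_cst. Qed.

Lemma ctends0D (f g : R -> C) : ctends0 f -> ctends0 g ->
  ctends0 (fun t => f t + g t).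
Proof.
move=> [fr fi] [gr gi].
split.
  apply: (cvg0_ext (fun t => ReD (f t) (g t))).
  by rewrite -[X in _ --> X]addr0; apply: cvgD.
apply: (cvg0_ext (fun t => ImD (f t) (g t))).
by rewrite -[X in _ --> X]addr0; apply: cvgD.
Qed.

Lemma ctends0Ml (c : C) (f : R -> C) : ctends0 f -> ctends0 (fun t => c * f t).
Proof.
move=> [fr fi].
have Z (a b : R) : (a * 0 - b * 0 = 0) * (a * 0 + b * 0 = 0).
  by rewrite !mulr0 subrr addr0.
split.
  apply: (cvg0_ext (fun t => ReM c (f t))).
  by rewrite -[X in _ --> X](Z (Re c) (Im c)).1; apply: cvgB; apply: cvgMr.
apply: (cvg0_ext (fun t => ImM c (f t))).
by rewrite -[X in _ --> X](Z (Re c) (Im c)).2; apply: cvgD; apply: cvgMr.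
Qed.

Definition has_cderivmx p q (X dX : R -> 'M[C]_(p, q)) : Prop :=
  forall k l, has_cderiv (fun t => X t k l) (fun t => dX t k l).

Definition ctends0mx p q (X : R -> 'M[C]_(p, q)) : Prop :=
  forall k l, ctends0 (fun t => X t k l).

Lemma has_cderiv_sum (I : Type) (s : seq I) (f df : I -> R -> C) :
  (forall i, has_cderiv (f i) (df i)) ->
  has_cderiv (fun t => \sum_(i <- s) f i t) (fun t => \sum_(i <- s) df i t).
Proof.
move=> fd; elim: s => [|i s IH].
  by apply: (eq_has_cderiv _ _ (has_cderiv_const 0)) => t; rewrite big_nil.
by apply: (eq_has_cderiv _ _ (has_cderivD (fd i) IH)) => t; rewrite big_cons.
Qed.

Lemma ctends0_sum (I : Type) (s : seq I) (f : I -> R -> C) :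
  (forall i, ctends0 (f i)) -> ctends0 (fun t => \sum_(i <- s) f i t).
Proof.
move=> fd; elim: s => [|i s IH].
  by apply: (eq_ctends0 _ ctends0_const0) => t; rewrite big_nil.
by apply: (eq_ctends0 _ (ctends0D (fd i) IH)) => t; rewrite big_cons.
Qed.

Lemma has_cderivmxMl m p q (P : 'M[C]_(m, p)) (X dX : R -> 'M[C]_(p, q)) :
  has_cderivmx X dX -> has_cderivmx (fun t => P *m X t) (fun t => P *m dX t).
Proof.
move=> Xd k l.
apply: (eq_has_cderiv _ _ (has_cderiv_sum (index_enum _)
  (fun i => has_cderivMl (P k i) (Xd i l)))) => t; exact: mxE.
Qed.

Lemma has_cderivmxMr m p q (P : 'M[C]_(q, m)) (X dX : R -> 'M[C]_(p, q)) :
  has_cderivmx X dX -> has_cderivmx (fun t => X t *m P) (fun t => dX t *m P).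
Proof.
move=> Xd k l.
apply: (eq_has_cderiv _ _ (has_cderiv_sum (index_enum _)
  (fun i => has_cderivMl (P i l) (Xd k i)))) => t;
  by rewrite mxE; apply: eq_bigr => i _; rewrite mulrC.
Qed.

Lemma ctends0mxD p q (X Y : R -> 'M[C]_(p, q)) :
  ctends0mx X -> ctends0mx Y -> ctends0mx (fun t => X t + Y t).
Proof.
move=> X0 Y0 k l.
by apply: (eq_ctends0 _ (ctends0D (X0 k l) (Y0 k l))) => t; rewrite mxE.
Qed.

Lemma ctends0mxMl m p q (P : 'M[C]_(m, p)) (X : R -> 'M[C]_(p, q)) :
  ctends0mx X -> ctends0mx (fun t => P *m X t).
Proof.
move=> X0 k l; apply: (eq_ctends0 _ (ctends0_sum (index_enum _)
  (fun i => ctends0Ml (P k i) (X0 i l)))) => t; exact: mxE.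
Qed.

Lemma ctends0mxMr m p q (P : 'M[C]_(q, m)) (X : R -> 'M[C]_(p, q)) :
  ctends0mx X -> ctends0mx (fun t => X t *m P).
Proof.
move=> X0 k l; apply: (eq_ctends0 _ (ctends0_sum (index_enum _)
  (fun i => ctends0Ml (P i l) (X0 k i)))) => t.
by rewrite mxE; apply: eq_bigr => i _; rewrite mulrC.
Qed.

Lemma ctends0mxN p q (X : R -> 'M[C]_(p, q)) :
  ctends0mx X -> ctends0mx (fun t => - X t).
Proof.
by move=> X0 k l; apply: (eq_ctends0 _ (ctends0Ml (-1) (X0 k l))) => t;
  rewrite mxE mulN1r.
Qed.

Lemma has_cderivmxC p q (X dX : R -> 'M[R]_(p, q)) :
  has_deriv X dX -> has_cderivmx (fun t => mxC (X t)) (fun t => mxC (dX t)).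
Proof.
move=> Xd k l; apply: (@eq_has_cderiv _ (fun t => real_complex R (X t k l)) _
  (fun t => real_complex R (dX t k l))) => t; try exact: mxE.
by split; [exact: Xd | exact: is_derive_cst].
Qed.

Lemma ctends0mxC p q (X : R -> 'M[R]_(p, q)) :
  ctends0mx (fun t => mxC (X t)) <-> tends_to_zero X.
Proof.
split=> X0 k l.
  by have [+ _] := X0 k l; apply: cvg0_ext => t; rewrite mxE.
apply: (@eq_ctends0 _ (fun t => real_complex R (X t k l))) => [t|]; first exact: mxE.
by split; [exact: X0 | exact: cvg_cst].
Qed.

(* A row [r] killed by [(M - z1) ... (M - zk)] satisfies [r X -> 0]: the factors
   are removed one at a time, each giving a scalar equation [f' = z f + o(1)]. *)
Lemma hurwitz_decay m q (M : 'M[C]_m) (X G : R -> 'M[C]_(m, q)) :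
  (forall z, eigenvalue M z -> Re z < 0) ->
  has_cderivmx X (fun t => M *m X t + G t) -> ctends0mx G -> ctends0mx X.
Proof.
move=> hM Xd G0; have [zs [ch _ eig]] := char_poly_roots M.
suff main (r : 'rV_m) : r *m mxprod M zs = 0 -> ctends0mx (fun t => r *m X t).
  move=> k l; have := main (delta_mx 0 k); rewrite (mxprod_char ch) mulmx0.
  by move=> /(_ erefl 0 l); apply: eq_ctends0 => t; rewrite -rowE mxE.
have : forall z, z \in zs -> Re z < 0 by move=> z; rewrite -eig; exact: hM.
elim: zs r {ch eig} => [|z zs IH] r zs0 /=.
  rewrite mulmx1 => -> k l; apply: (eq_ctends0 _ ctends0_const0) => t.
  by rewrite mul0mx mxE.
rewrite mulmxA => /IH h k l.
have {}h : ctends0mx (fun t => r *m (M - z%:M) *m X t).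
  by apply: h => w wzs; apply: zs0; rewrite inE wzs orbT.
apply: (@cderiv_decay _ z _ (fun t => (r *m (M - z%:M) *m X t + r *m G t) k l)).
- by apply: zs0; rewrite mem_head.
- apply: eq_has_cderiv (has_cderivmxMl r Xd k l) => t //.
  rewrite mulmxDr mulmxBr mulmxBl mul_mx_scalar -scalemxAl !mulmxA !mxE.
  by ring.
exact: ctends0mxD h (ctends0mxMl r G0) k l.
Qed.

Lemma hurwitz_decay_real n q (A : 'M[R]_n) (X G : R -> 'M[R]_(n, q)) :
  hurwitz A -> has_deriv X (fun t => A *m X t + G t) -> tends_to_zero G ->
  tends_to_zero X.
Proof.
move=> hA /has_cderivmxC Xd /ctends0mxC G0; apply/ctends0mxC.
apply: (hurwitz_decay hA _ G0).
move=> k l; apply: eq_has_cderiv (Xd k l) => t //.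
by rewrite map_mxD map_mxM.
Qed.

(** Factors are peeled off on the right: E c satisfies (E c)' = (A - z) E c - E (L - z) c + G c. The
    shift by z makes A - z Hurwitz, and E (L - z) c decays by induction because the factors commute.
    No diagonalisation of [L] enters. *)
Lemma sylvester_decay n N (A : 'M[C]_n) (L : 'M[C]_N) (E G : R -> 'M[C]_(n, N))
    (zs : seq C) (c : 'cV[C]_N) :
  (forall z, eigenvalue A z -> Re z <= 0) -> (forall z, z \in zs -> 0 < Re z) ->
  has_cderivmx E (fun t => A *m E t - E t *m L + G t) -> ctends0mx G ->
  mxprod L zs *m c = 0 -> ctends0mx (fun t => E t *m c).
Proof.
move=> hA zs0 Ed G0; elim: zs zs0 c => [|z zs IH] zs0 c /=.
  rewrite mul1mx => -> k l; apply: (eq_ctends0 _ ctends0_const0) => t.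
  by rewrite mulmx0 mxE.
rewrite mulmxBl mxprodC -scalar_mxC -mulmxBr -mulmxA => /IH h.
have {}h : ctends0mx (fun t => E t *m ((L - z%:M) *m c)).
  by apply: h => w wzs; apply: zs0; rewrite inE wzs orbT.
have z0 : 0 < Re z by apply: zs0; rewrite mem_head.
apply: (@hurwitz_decay _ _ (A - z%:M) _
   (fun t => - (E t *m ((L - z%:M) *m c)) + G t *m c)).
- move=> w /eigenvalueP[v vA v0]; have : eigenvalue A (w + z).
    apply/eigenvalueP; exists v => //; rewrite scalerDl -vA mulmxBr mul_mx_scalar.
    by rewrite subrK.
  by move=> /hA; rewrite ReD; lra.
- move=> k l; apply: eq_has_cderiv (has_cderivmxMr c Ed k l) => t //.
  have -> : (L - z%:M) *m c = L *m c - z *: c by rewrite mulmxBl mul_scalar_mx.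
  have -> : (A - z%:M) *m (E t *m c) = A *m E t *m c - z *: (E t *m c).
    by rewrite mulmxBl mul_scalar_mx mulmxA.
  rewrite mulmxBr -scalemxAr mulmxA !mulmxDl mulNmx.
  move: (A *m E t *m c) (E t *m L *m c) (z *: (E t *m c)) (G t *m c) => a b d e.
  by rewrite !mxE; ring.
by apply: ctends0mxD; [exact: ctends0mxN | exact: ctends0mxMr].
Qed.

End MatrixDecay.

(** * Graph Laplacians *)

Section Laplacian.
Variable R : realType.
Local Notation C := R[i].
Local Notation Re := (@complex.Re R).
Local Notation Im := (@complex.Im R).

(** Zero row sums leave only differences of values. The morphism [f] lets one identity serve both
    real vectors and complex eigenvectors. *)
Lemma laplacian_sum N (a : 'M[R]_N) (S : comNzRingType)
    (f : {rmorphism R -> S}) (v : 'I_N -> S) i : adjacency a ->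
  \sum_j f (laplacian a i j) * v j = \sum_j f (a i j) * (v i - v j).
Proof.
move=> [_ a0]; rewrite (bigD1 i) //= mxE eqxx [RHS](bigD1 i) //=.
rewrite subrr mulr0 add0r [\sum_(k < N) a i k](bigD1 i) //= a0 add0r.
rewrite rmorph_sum mulr_suml -big_split /=; apply: eq_bigr => j ji.
by rewrite mxE eq_sym (negbTE ji) rmorphN mulrBr mulNr.
Qed.

Lemma argmax_ord N (r : 'I_N) (v : 'I_N -> R) : exists i, forall k, v k <= v i.
Proof.
by have [i _ iP] := @Order.TotalTheory.arg_maxP _ _ _ r xpredT v isT;
  exists i => k; apply: iP.
Qed.

Section Harmonic.
Variables (N : nat) (a : 'M[R]_N).
Hypotheses (adj : adjacency a) (tree : has_spanning_tree a).

Let lap (v : 'I_N -> R) i := \sum_j laplacian a i j * v j.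

Let lapE v i : lap v i = \sum_j a i j * (v i - v j).
Proof. exact: (@laplacian_sum _ a R idfun). Qed.

Lemma laplacian_argmax_ge0 v i : (forall k, v k <= v i) -> 0 <= lap v i.
Proof.
move=> vi; rewrite lapE; apply: sumr_ge0 => j _.
by rewrite mulr_ge0 ?subr_ge0 //; case: adj.
Qed.

Lemma laplacian_oppr v i : lap (fun k => - v k) i = - lap v i.
Proof. by rewrite -sumrN; apply: eq_bigr => j _; rewrite mulrN. Qed.

(** The constant is nonnegative at a maximum of [v] and nonpositive at a minimum. *)
Lemma laplacian_const_eq0 v c : (forall i, lap v i = c) -> c = 0.
Proof.
have [r _] := tree; move=> vc; apply/eqP; rewrite eq_le.
have [i /laplacian_argmax_ge0] := argmax_ord r v; rewrite vc => ->.
have [j /laplacian_argmax_ge0] := argmax_ord r (fun k => - v k).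
by rewrite laplacian_oppr vc oppr_ge0 => ->.
Qed.

(** At a maximum the vanishing sum has nonnegative terms, so every node with an edge into it attains
    the maximum too. The maximum thus travels backwards along a path to the root. *)
Lemma harmonic_max_at_root v r : (forall i, connect (edge a) r i) ->
  (forall i, lap v i = 0) -> forall k, v k <= v r.
Proof.
move=> tr v0; have [i vi] := argmax_ord r v.
have /connectP[p pth ip] := tr i; rewrite ip in vi.
elim: p r pth vi {tr ip} => [|x p IH] r //= /andP[rx pth] vi k.
apply: le_trans (IH _ pth vi k) _.
have vx := IH _ pth vi; have := v0 x; rewrite lapE => /eqP.
rewrite psumr_eq0 => [/allP/(_ r)|j _]; last first.
  by rewrite mulr_ge0 ?subr_ge0 //; case: adj.
rewrite mem_index_enum => /(_ isT) /=; rewrite mulf_eq0 gt_eqF //=.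
by rewrite subr_eq0 => /eqP ->.
Qed.

Lemma harmonic_const v : (forall i, lap v i = 0) -> forall i j, v i = v j.
Proof.
move=> v0; have [r tr] := tree; suff vr i : v i = v r by move=> i j; rewrite !vr.
apply/eqP; rewrite eq_le (harmonic_max_at_root tr) //=.
rewrite -lerN2; apply: (harmonic_max_at_root tr (v := fun k => - v k)) => k.
by rewrite laplacian_oppr v0 oppr0.
Qed.

(** The eigenvalue 0 is semisimple: each column of L V is harmonic, hence constant, and a constant
    in the image of L is 0. *)
Lemma laplacian_ker_sqr q (V : 'M[R]_(N, q)) :
  laplacian a *m (laplacian a *m V) = 0 -> laplacian a *m V = 0.
Proof.
move=> LLV; apply/matrixP => i l; rewrite [RHS]mxE.
pose w k := (laplacian a *m V) k l.
have w0 k : lap w k = 0 by have := congr1 (fun Z : 'M[R]_(N, q) => Z k l) LLV; rewrite !mxE.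
have wc k : w k = w i := harmonic_const w0 k i.
by apply: (@laplacian_const_eq0 (fun k => V k l)) => k; rewrite -[RHS]/(w i) -(wc k) /w mxE.
Qed.

Lemma laplacian_ker_const q (V : 'M[R]_(N, q)) :
  laplacian a *m V = 0 -> forall i j l, V i l = V j l.
Proof.
move=> LV i j l; apply: (harmonic_const (v := fun k => V k l)) => k.
by have := congr1 (fun Z : 'M[R]_(N, q) => Z k l) LV; rewrite !mxE.
Qed.

(** Gershgorin at a coordinate of largest modulus: z lies in the disc of centre d and radius d, with
    d the row sum of weights, and that disc meets Re <= 0 only at 0. The transpose supplies a right
    eigenvector, on which the row sums act. *)
Lemma laplacian_eigenvalue z :
  eigenvalue (mxC (laplacian a)) z -> z = 0 \/ 0 < Re z.
Proof.
rewrite -eigenvalue_tr => /eigenvalueP[v vL v0].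
have vE i : \sum_j (real_complex R (a i j)) * (v 0 i - v 0 j) = z * v 0 i.
  rewrite -(laplacian_sum (real_complex R) (v 0) i adj).
  have := congr1 (fun Z : 'rV_N => Z 0 i) vL; rewrite !mxE => <-.
  by apply: eq_bigr => j _; rewrite !mxE mulrC.
pose nr (x : C) := Num.sqrt (Re x ^+ 2 + Im x ^+ 2).
have [r _] := tree; have [i vi] := argmax_ord r (fun i => nr (v 0 i)).
have vle k : `|v 0 k| <= `|v 0 i| by rewrite !normc_def lecR; exact: vi.
have vi0 : v 0 i != 0.
  apply: contra v0 => /eqP vi0; apply/eqP/matrixP => k j; rewrite ord1 [RHS]mxE.
  apply/eqP; rewrite -normr_le0; apply: le_trans (vle j) _.
  by rewrite vi0 normr0.
pose d := \sum_j a i j.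
have d0 : 0 <= d by apply: sumr_ge0 => j _; case: adj.
have : `|(d%:C)%C - z| <= (d%:C)%C.
  have nv0 : 0 < `|v 0 i| by rewrite normr_gt0.
  rewrite -(ler_pM2r nv0) -normrM.
  have -> : ((d%:C)%C - z) * v 0 i = \sum_j (real_complex R (a i j)) * v 0 j.
    rewrite mulrBl -vE rmorph_sum mulr_suml -sumrB; apply: eq_bigr => j _ /=.
    by rewrite mulrBr opprB addrC subrK.
  apply: le_trans (ler_norm_sum _ _ _) _.
  rewrite rmorph_sum mulr_suml; apply: ler_sum => j _ /=.
  have aij : 0 <= real_complex R (a i j) by rewrite ler0c; case: adj.
  rewrite normrM (ger0_norm aij) ler_wpM2l //.
rewrite normc_def lecR /=; case: z {vL vE} => x y /= h.
have {}h : (d - x) ^+ 2 + (0 - y) ^+ 2 <= d ^+ 2.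
  have s0 : 0 <= (d - x) ^+ 2 + (0 - y) ^+ 2 by rewrite addr_ge0 ?sqr_ge0.
  by rewrite -(sqr_sqrtr s0); apply: lerXn2r; rewrite ?nnegrE ?sqrtr_ge0.
have [x0|x0] := ltP 0 x; [by right | left].
have h1 : x ^+ 2 + y ^+ 2 <= 0.
  have : d * x <= 0 by rewrite mulr_ge0_le0.
  by move: h; rewrite !expr2; lra.
have := sqr_ge0 x; have := sqr_ge0 y => y2 x2.
apply/eqP; rewrite eq_complex /= -(sqrf_eq0 x) -(sqrf_eq0 y).
by apply/andP; split; apply/eqP; lra.
Qed.

End Harmonic.

Lemma mxprod_tr (F : fieldType) m (M : 'M[F]_m) zs :
  mxprod M^T zs = (mxprod M zs)^T.
Proof.
elim: zs => [|z zs IH] /=; first by rewrite trmx1.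
rewrite IH [in RHS]mulmxBl mxprodC -scalar_mxC -mulmxBr trmx_mul.
by rewrite [(_ - _)^T]linearB /= tr_scalar_mx.
Qed.

(* [char_poly L = q * 'X^m] with [q] nonzero at [0]: since [ker L^2 = ker L] is
   spanned by the constant vector, all the rows of [q(L)] coincide. *)
Lemma laplacian_annihilator N (a : 'M[R]_N) :
  adjacency a -> has_spanning_tree a ->
  exists zs : seq C, (forall z, z \in zs -> 0 < Re z) /\
    forall i j, mxprod (mxC (laplacian a))^T zs *m (delta_mx i 0 - delta_mx j 0)
                = 0 :> 'cV[C]_N.
Proof.
case: N a => [|N] a adj tree; first by have [[]] := tree.
set L := laplacian a.
have [m [q q0 chE]] := multiplicity_XsubC (char_poly L) 0.
rewrite monic_neq0 ?char_poly_monic //= in q0.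
have LQ0 : L *m horner_mx L q = 0.
  have : L ^+ m *m horner_mx L q = 0.
    have := Cayley_Hamilton L; rewrite chE mulrC rmorphM rmorphXn /= rmorphB /=.
    by rewrite horner_mx_X horner_mx_C raddf0 subr0.
  (* Since L^2 and L have the same kernel, the power of L from Cayley-Hamilton is lowered to a
     single L. *)
  elim: m {chE} => [|m IH]; first by rewrite expr0 mul1mx => ->; rewrite mulmx0.
  case: m IH => [|m] IH; first by rewrite expr1.
  rewrite 2!exprS -!mulmxA -/L => h; apply: IH.
  by rewrite exprS -!mulmxA; apply: laplacian_ker_sqr.
have Qc := laplacian_ker_const adj tree LQ0.
have [zs zsE] := closed_field_poly_normal (map_poly (real_complex R) q).
set c := lead_coef _ in zsE.
have c0 : c != 0.
  rewrite lead_coef_eq0 map_poly_eq0; apply: contraNneq q0 => ->.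
  exact: root0.
exists zs; split=> [z zzs|i j].
  have zr : root (map_poly (real_complex R) q) z.
    by rewrite zsE rootZ // root_prod_XsubC.
  have [z0|//] : z = 0 \/ 0 < Re z.
    apply: (laplacian_eigenvalue adj tree).
    rewrite eigenvalue_root_char -map_char_poly chE rmorphM /= rootM.
    by rewrite zr.
  by move: zr; rewrite z0 -(rmorph0 (real_complex R)) fmorph_root (negbTE q0).
rewrite mxprod_tr; apply/matrixP => k l; rewrite mulmxBr -!colE !mxE.
suff E s : mxprod (mxC L) zs s k = c^-1 * real_complex R (horner_mx L q s k).
  by rewrite !E (Qc i j) subrr.
have -> : mxprod (mxC L) zs = c^-1 *: mxC (horner_mx L q).
  rewrite mxprod_horner map_horner_mx zsE linearZ /= scalerA mulVf //.
  by rewrite scale1r.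
by rewrite !mxE.
Qed.

End Laplacian.

(** * The observer-based protocol *)

Section Sufficiency.
Variable R : realType.

Lemma eq_has_deriv p q (X X' dX dX' : R -> 'M[R]_(p, q)) :
  X =1 X' -> dX =1 dX' -> has_deriv X' dX' -> has_deriv X dX.
Proof. by move=> /funext -> /funext ->. Qed.

Lemma has_derivB p q (X dX Y dY : R -> 'M[R]_(p, q)) :
  has_deriv X dX -> has_deriv Y dY ->
  has_deriv (fun t => X t - Y t) (fun t => dX t - dY t).
Proof.
move=> Xd Yd t k l.
rewrite (_ : (fun s => (X s - Y s) k l) = (fun s => X s k l) \- (fun s => Y s k l)).
  by rewrite !mxE; apply: is_deriveB.
by apply/funext => s; rewrite !mxE.
Qed.

Lemma has_derivMr p q m (P : 'M[R]_(q, m)) (X dX : R -> 'M[R]_(p, q)) :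
  has_deriv X dX -> has_deriv (fun t => X t *m P) (fun t => dX t *m P).
Proof.
move=> Xd t k l.
rewrite (_ : (fun s => (X s *m P) k l) = \sum_i (fun s => X s k i * P i l)).
  rewrite mxE; apply: is_derive_sum => i.
  by have := Xd t k i => ?; apply: trigger_derive;
     rewrite /GRing.scale /= mulr0 add0r mulrC.
by apply/funext => s; rewrite mxE fct_sumE.
Qed.

(** The agents' states become the columns of one n x N matrix, so that dynamics act on the left and
    the network acts on the right by the transposed Laplacian. *)
Lemma has_deriv_pack n N (x dx : 'I_N -> R -> 'cV[R]_n) :
  (forall i, has_deriv (x i) (dx i)) ->
  has_deriv (fun t => \matrix_(k, i) x i t k 0) (fun t => \matrix_(k, i) dx i t k 0).
Proof.
move=> xd t k l; rewrite mxE.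
by under eq_fun do rewrite mxE; exact: xd.
Qed.

Lemma packM n m N (P : 'M[R]_(m, n)) (x : 'I_N -> 'cV[R]_n) :
  \matrix_(k, i) (P *m x i) k 0 = P *m \matrix_(k, i) x i k 0.
Proof.
apply/matrixP => k i; rewrite !mxE.
by apply: eq_bigr => j _; rewrite mxE.
Qed.

Lemma pack_sum n N (L : 'M[R]_N) (x : 'I_N -> 'cV[R]_n) :
  \matrix_(k, i) (\sum_j L i j *: x j) k 0 = (\matrix_(k, i) x i k 0) *m L^T.
Proof.
apply/matrixP => k i; rewrite !mxE summxE.
by apply: eq_bigr => j _; rewrite !mxE mulrC.
Qed.

Lemma packD n N (x y : 'I_N -> 'cV[R]_n) :
  \matrix_(k, i) (x i + y i) k 0 =
  \matrix_(k, i) x i k 0 + \matrix_(k, i) y i k 0.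
Proof. by apply/matrixP => k i; rewrite !mxE. Qed.

Section Observer.
Variables (n N : nat) (A : 'M[R]_n) (B : 'cV[R]_n) (C : 'rV[R]_n).
Variables (F : 'rV[R]_n) (K : 'cV[R]_n) (a : 'M[R]_N).
Hypotheses (adj : adjacency a) (tree : has_spanning_tree a).
Hypotheses (hF : hurwitz (A + B *m F)) (hK : hurwitz (A + K *m C)).
Hypothesis hA : eig_closed_lhp A.
Local Notation Lt := (laplacian a)^T.

Lemma observer_synchronization (X Xh Ch : R -> 'M[R]_(n, N)) :
  has_deriv X (fun t => A *m X t + B *m F *m Ch t) ->
  has_deriv Xh (fun t => (A + K *m C) *m Xh t - K *m C *m (X t *m Lt)
                         + B *m F *m (Ch t *m Lt)) ->
  has_deriv Ch (fun t => Xh t + (A + B *m F) *m Ch t - Ch t *m Lt) ->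
  forall i j k, (fun t => X t k i - X t k j) @ +oo --> (0 : R).
Proof.
move=> Xd Xhd Chd.
have Eh0 : tends_to_zero (fun t => X t *m Lt - Xh t).
  apply: (hurwitz_decay_real hK (G := fun=> 0)); last first.
    by move=> k l; apply: cvg0_ext (cvg_cst _) => t; rewrite mxE.
  apply: eq_has_deriv (has_derivB (has_derivMr Lt Xd) Xhd) => // t.
  rewrite addr0 mulmxBr !mulmxDl !mulmxA.
  move: (A *m X t *m Lt) (K *m C *m X t *m Lt) (A *m Xh t) (K *m C *m Xh t)
    (B *m F *m Ch t *m Lt) => p1 p2 p3 p4 p5.
  by apply/matrixP => k l; rewrite !mxE; ring.
have Ed : has_deriv (fun t => X t - Ch t)
    (fun t => A *m (X t - Ch t) - (X t - Ch t) *m Lt + (X t *m Lt - Xh t)).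
  apply: eq_has_deriv (has_derivB Xd Chd) => // t.
  rewrite mulmxBr mulmxBl mulmxDl.
  move: (A *m X t) (A *m Ch t) (X t *m Lt) (Ch t *m Lt) (B *m F *m Ch t) (Xh t).
  by move=> p1 p2 p3 p4 p5 p6; apply/matrixP => k l; rewrite !mxE; ring.
(* Right multiplication by [c] takes the difference of columns i and j; [laplacian_annihilator]
   kills [c] by factors with roots in Re > 0. *)
move=> i j k; pose c : 'cV[R]_N := delta_mx i 0 - delta_mx j 0.
have Ec : tends_to_zero (fun t => (X t - Ch t) *m c).
  apply/ctends0mxC; have [zs [zs0 zsc]] := laplacian_annihilator adj tree.
  have := @sylvester_decay _ _ _ (cmx A) (mxC (laplacian a))^T
    (fun t => mxC (X t - Ch t)) (fun t => mxC (X t *m Lt - Xh t)) zs (mxC c) hA zs0.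
  have Ed' := has_cderivmxC Ed.
  have cE : mxprod (mxC (laplacian a))^T zs *m mxC c = 0.
    by rewrite map_mxB !map_delta_mx zsc.
  move=> h k' l'; apply: (eq_ctends0 _ (h _ _ cE k' l')).
  - by move=> t; rewrite map_mxM.
  - move=> k1 l1; apply: eq_has_cderiv (Ed' k1 l1) => // t.
    by rewrite map_trmx -!map_mxM -map_mxB -map_mxD.
  by apply/ctends0mxC.
(* Writing Ch = X - (X - Ch) turns the agent equation into A + B F driven by a decaying term. *)
have Xc : tends_to_zero (fun t => X t *m c).
  apply: (hurwitz_decay_real hF (G := fun t => - (B *m F *m ((X t - Ch t) *m c)))).
    apply: eq_has_deriv (has_derivMr c Xd) => // t.
    move: (c) => d; rewrite mulmxBl mulmxBr !mulmxDl !mulmxA.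
    move: (A *m X t *m d) (B *m F *m X t *m d) (B *m F *m Ch t *m d) => p1 p2 p3.
    by apply/matrixP => k' l; rewrite !mxE; ring.
  apply/ctends0mxC; move/ctends0mxC : Ec => /(ctends0mxMl (mxC (B *m F))).
  move=> /ctends0mxN Ec k' l; apply: eq_ctends0 (Ec k' l) => t.
  by rewrite map_mxN map_mxM.
apply: cvg0_ext (Xc k 0) => t.
by rewrite mulmxBr -!colE !mxE.
Qed.

End Observer.

Lemma protocol_exists n (A : 'M[R]_n) (B : 'cV[R]_n) (C : 'rV[R]_n) :
  stabilizable A B -> detectable C A -> eig_closed_lhp A ->
  exists (nc q : nat) (Ac : 'M[R]_nc) (Bc : 'M[R]_(nc, 1)) (Ec : 'M[R]_(nc, q))
         (Fc : 'M[R]_(1, nc)) (G1 : 'M[R]_1) (G2 : 'M[R]_(1, q))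
         (Hc : 'M[R]_(q, nc)),
    forall (N : nat) (a : 'M[R]_N),
      adjacency a -> has_spanning_tree a ->
      forall (x : 'I_N -> R -> 'cV[R]_n) (xc : 'I_N -> R -> 'cV[R]_nc),
        closed_loop A B C Ac Bc Ec Fc G1 G2 Hc a x xc ->
        forall i j : 'I_N, tends_to_zero (fun t => x i t - x j t).
Proof.
move=> [F hF] [K hK] hA.
(* The state is (xh, chi) and chi is what is exchanged. As u_j = F chi_j, the sum of l_ij B u_j is B
   F applied to the exchanged signal, which gives the upper block of [Ec]. *)
exists (n + n)%N, n, (block_mx (A + K *m C) 0 1%:M (A + B *m F)), (col_mx (- K) 0),
  (col_mx (B *m F) (- 1%:M)), (row_mx 0 F), 0, 0, (row_mx 0 1%:M).
move=> N a adj tree x xc cl i j k l; rewrite ord1.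
pose xh i t := usubmx (xc i t); pose ch i t := dsubmx (xc i t).
have xcE i' t : xc i' t = col_mx (xh i' t) (ch i' t) by rewrite vsubmxK.
have zhE i' t : \sum_(j < N) laplacian a i' j *: (row_mx 0 1%:M *m xc j t) =
    \sum_(j < N) laplacian a i' j *: ch j t.
  by apply: eq_bigr => j' _; rewrite xcE mul_row_col mul0mx add0r mul1mx.
have zE i' t : \sum_(j < N) laplacian a i' j *: (C *m x j t) =
    C *m \sum_(j < N) laplacian a i' j *: x j t.
  by rewrite mulmx_sumr; apply: eq_bigr => j' _; rewrite scalemxAr.
pose pk (f : 'I_N -> R -> 'cV[R]_n) t := \matrix_(k, i) f i t k 0.
have xd i' : has_deriv (x i') (fun t => A *m x i' t + B *m F *m ch i' t).
  have [+ _] := cl i'; apply: eq_has_deriv => // t.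
  by rewrite !mul0mx !addr0 xcE mul_row_col mul0mx add0r mulmxA.
have xcd i' t : block_mx (A + K *m C) 0 1%:M (A + B *m F) *m xc i' t
    + col_mx (- K) 0 *m (\sum_(j < N) laplacian a i' j *: (C *m x j t))
    + col_mx (B *m F) (- 1%:M) *m
        (\sum_(j < N) laplacian a i' j *: (row_mx 0 1%:M *m xc j t)) =
  col_mx ((A + K *m C) *m xh i' t
            + - (K *m C) *m (\sum_(j < N) laplacian a i' j *: x j t)
            + B *m F *m (\sum_(j < N) laplacian a i' j *: ch j t))
         (xh i' t + (A + B *m F) *m ch i' t
            + - 1%:M *m (\sum_(j < N) laplacian a i' j *: ch j t)).
  rewrite zhE zE {1}xcE mul_block_col !mul_col_mx !add_col_mx.
  by rewrite !mul0mx !addr0 !mul1mx mulmxA mulNmx.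
have xhd i' : has_deriv (xh i') (fun t => (A + K *m C) *m xh i' t
      + - (K *m C) *m (\sum_(j < N) laplacian a i' j *: x j t)
      + B *m F *m (\sum_(j < N) laplacian a i' j *: ch j t)).
  move=> t k' l'; have [_ /(_ t (lshift n k') l')] := cl i'; rewrite xcd col_mxEu.
  by congr is_derive; apply/funext => s; rewrite mxE.
have chd i' : has_deriv (ch i') (fun t => xh i' t + (A + B *m F) *m ch i' t
      + - 1%:M *m (\sum_(j < N) laplacian a i' j *: ch j t)).
  move=> t k' l'; have [_ /(_ t (rshift n k') l')] := cl i'; rewrite xcd col_mxEd.
  by congr is_derive; apply/funext => s; rewrite mxE.
have := @observer_synchronization n N A B C F K a adj tree hF hK hA
  (pk x) (pk xh) (pk ch).
move=> /(_ _ _ _ i j k) h.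
apply: cvg0_ext (h _ _ _) => [t|||].
- by rewrite !mxE.
- by apply: eq_has_deriv (has_deriv_pack xd) => // t; rewrite packD !packM.
- apply: eq_has_deriv (has_deriv_pack xhd) => // t.
  by rewrite !packD !packM !pack_sum mulNmx.
apply: eq_has_deriv (has_deriv_pack chd) => // t.
by rewrite !packD !packM !pack_sum mulNmx mul1mx.
Qed.

End Sufficiency.

(** * Existence of solutions *)

Section LinearODE.
Variables (R : realType) (m : nat) (M : 'M[R]_m).

(** Coordinate [i] of the Taylor coefficient M^k x0 / k! of exp(t M) x0, so that each coordinate is
    a scalar power series. *)
Definition exp_mx_coeff (x0 : 'cV[R]_m) (i : 'I_m) (k : nat) : R :=
  iter k (mulmx M) x0 i 0 / k`!%:R.

Lemma iter_mulmx_bound (x0 : 'cV[R]_m) k i :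
  `|iter k (mulmx M) x0 i 0| <=
  (\sum_j `|x0 j 0|) * (\sum_i \sum_j `|M i j|) ^+ k.
Proof.
elim: k i => [|k IH] i /=.
  by rewrite expr0 mulr1 (bigD1 i) //= lerDl sumr_ge0.
rewrite mxE; apply: le_trans (ler_norm_sum _ _ _) _.
have le1 : \sum_j `|M i j| <= \sum_i \sum_j `|M i j|.
  by rewrite [leRHS](bigD1 i) //= lerDl sumr_ge0 // => j _; rewrite sumr_ge0.
rewrite exprSr mulrA [leRHS]mulrC.
apply: le_trans (_ : (\sum_j `|M i j|) * _ <= _); last first.
  apply: ler_wpM2r le1; rewrite mulr_ge0 ?sumr_ge0 // exprn_ge0 // sumr_ge0 //.
  by move=> j _; rewrite sumr_ge0.
by rewrite mulr_suml; apply: ler_sum => j _; rewrite normrM ler_wpM2l.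
Qed.

Lemma is_cvg_exp_mx x0 i t : cvgn (pseries (exp_mx_coeff x0 i) t).
Proof.
pose K := \sum_j `|x0 j 0|; pose D := \sum_i \sum_j `|M i j|.
have K0 : 0 <= K by rewrite sumr_ge0.
have D0 : 0 <= D by rewrite sumr_ge0 // => j _; rewrite sumr_ge0.
apply: normed_cvg; apply: (series_le_cvg (v_ := K *: exp_coeff (D * `|t|))).
- by move=> k; rewrite normr_ge0.
- by move=> k; rewrite mulr_ge0 // divr_ge0 // exprn_ge0 // mulr_ge0.
- move=> k; have -> : (K *: exp_coeff (D * `|t|)) k =
      K * D ^+ k * `|t| ^+ k / k`!%:R.
    by rewrite -!mulrA [_ * (_ / _)]mulrA -exprMn.
  rewrite /= /exp_mx_coeff !normrM normfV normr_nat normrX mulrAC.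
  rewrite ler_wpM2r ?invr_ge0 // ler_wpM2r ?exprn_ge0 //.
  exact: iter_mulmx_bound.
by apply: is_cvg_seriesZ; exact: is_cvg_series_exp_coeff.
Qed.

Lemma exp_mx_coeff_diffs x0 i :
  pseries_diffs (exp_mx_coeff x0 i) = exp_mx_coeff (M *m x0) i.
Proof.
apply/funext => k; rewrite /pseries_diffs /exp_mx_coeff iterSr factS natrM invfM.
by rewrite mulrCA [_%:R * _]mulrA mulfV ?mul1r // pnatr_eq0.
Qed.

(** Necessity needs actual trajectories with prescribed initial values. Termwise differentiation of
    the exponential series replaces [x0] by [M x0]. *)
Lemma linear_ode_solution (x0 : 'cV[R]_m) :
  exists x : R -> 'cV[R]_m, has_deriv x (fun t => M *m x t) /\ x 0 = x0.
Proof.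
pose x t : 'cV[R]_m := \col_i limn (pseries (exp_mx_coeff x0 i) t).
exists x; split=> [t k l|]; last first.
  apply/matrixP => i j; rewrite ord1 mxE; apply: cvg_lim => //.
  apply: cvg_near_cst; exists 1%N => // -[|n] //= _.
  rewrite /pseries /series /= big_nat_recl // expr0 mulr1 big1_seq ?addr0.
    by rewrite /exp_mx_coeff fact0 divr1.
  by move=> k _; rewrite expr0n mulr0.
rewrite ord1; have -> : (fun s => x s k 0) =
    (fun s => limn (pseries (exp_mx_coeff x0 k) s)).
  by apply/funext => s; rewrite mxE.
have -> : (M *m x t) k 0 = limn (pseries (pseries_diffs (exp_mx_coeff x0 k)) t).
  rewrite exp_mx_coeff_diffs mxE; apply/esym/cvg_lim => //.
  have -> : pseries (exp_mx_coeff (M *m x0) k) t =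
      (fun N => \sum_j M k j * pseries (exp_mx_coeff x0 j) t N).
    apply/funext => N; rewrite /pseries /series /=.
    under [RHS]eq_bigr do rewrite mulr_sumr.
    rewrite exchange_big /=; apply: eq_bigr => p _.
    rewrite /exp_mx_coeff -iterSr /= mxE !mulr_suml; apply: eq_bigr => j _.
    by rewrite !mulrA.
  apply: cvg_big => [|j _]; first exact: add_continuous.
  apply: cvgMr; rewrite mxE.
  exact: is_cvg_exp_mx.
apply: (@pseries_snd_diffs _ _ (`|t| + 1)); rewrite ?exp_mx_coeff_diffs;
  try exact: is_cvg_exp_mx.
by rewrite [ltRHS]ger0_norm ?ltrDl // addr_ge0.
Qed.

End LinearODE.

(** * Rows along which all solutions decay *)

Section DecayingRows.
Variables (R : realType) (m : nat) (M : 'M[R]_m).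
Local Notation C := R[i].
Local Notation Re := (@complex.Re R).

Lemma has_derivMl p q m' (P : 'M[R]_(m', p)) (X dX : R -> 'M[R]_(p, q)) :
  has_deriv X dX -> has_deriv (fun t => P *m X t) (fun t => P *m dX t).
Proof.
move=> Xd; have XdT : has_deriv (fun t => (X t)^T) (fun t => (dX t)^T).
  move=> t k l; rewrite mxE (_ : (fun s => (X s)^T k l) = fun s => X s l k) //.
  by apply/funext => s; rewrite mxE.
have := has_derivMr P^T XdT => h t k l; have := h t l k.
rewrite -trmx_mul mxE; congr is_derive.
by apply/funext => s; rewrite -trmx_mul mxE.
Qed.

Definition decaying (r : 'rV[C]_m) : Prop := forall x : R -> 'cV[R]_m,
  has_deriv x (fun t => M *m x t) -> ctends0mx (fun t => r *m mxC (x t)).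

(** The derivative of a solution is again a solution, so decaying rows are stable under right
    multiplication by [M]. *)
Lemma decaying_factor r z : decaying r -> decaying (r *m (mxC M - z%:M)).
Proof.
move=> rD x xd k l.
have h1 := rD _ (has_derivMl M xd) k l.
have h2 := ctends0Ml (- z) (rD _ xd k l).
apply: (eq_ctends0 _ (ctends0D h1 h2)) => t.
rewrite mulmxBr mulmxBl map_mxM mulmxA mul_mx_scalar -scalemxAl.
by rewrite !mxE mulNr.
Qed.

Lemma decaying_mxprod r zs : decaying r -> decaying (r *m mxprod (mxC M) zs).
Proof.
elim: zs r => [|z zs IH] r rD /=; first by rewrite mulmx1.
by rewrite mulmxA; apply: IH; exact: decaying_factor.
Qed.

(** Along a solution, r x satisfies f' = z f and decays, so it vanishes at time 0; starting from the
    basis vectors gives every entry of [r]. *)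
Lemma decaying_unstable_eigenrow r z : 0 <= Re z -> decaying r ->
  r *m mxC M = z *: r -> r = 0.
Proof.
move=> z0 rD rM; apply/matrixP => k j; rewrite ord1 [RHS]mxE.
have [x [xd x0]] := linear_ode_solution M (delta_mx j 0).
have fd : has_cderiv (fun t => (r *m mxC (x t)) 0 0)
    (fun t => z * (r *m mxC (x t)) 0 0).
  apply: eq_has_cderiv (has_cderivmxMl r (has_cderivmxC xd) 0 0) => // t.
  by rewrite map_mxM mulmxA rM -scalemxAl [RHS]mxE.
have := cderiv_unstable z0 fd (rD _ xd 0 0).
by rewrite x0 map_delta_mx -colE mxE.
Qed.

Lemma decaying_unstable_eq0 r zs : (forall z, z \in zs -> 0 <= Re z) ->
  decaying r -> r *m mxprod (mxC M) zs = 0 -> r = 0.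
Proof.
elim: zs r => [|z zs IH] r zs0 rD /=; first by rewrite mulmx1.
rewrite mulmxA => h.
have r0 : r *m (mxC M - z%:M) = 0.
  apply: IH h; last exact: decaying_factor.
  by move=> w wzs; apply: zs0; rewrite inE wzs orbT.
apply: (@decaying_unstable_eigenrow _ z) => //; first by apply: zs0; rewrite mem_head.
by apply/eqP; rewrite -subr_eq0 -mul_mx_scalar -mulmxBr r0.
Qed.

(** Cayley-Hamilton kills [r] with all the factors. After the stable factors the row is still
    decaying, so the unstable ones can be cancelled. The size bound later gives estimates uniform in
    the coupling weight. *)
Lemma decaying_stable_annihilator : exists zs : seq C,
  [/\ (size zs <= m)%N, forall z, z \in zs -> Re z < 0
    & forall r, decaying r -> r *m mxprod (mxC M) zs = 0].
Proof.
have [zs [ch sz _]] := char_poly_roots (mxC M).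
pose st := fun z : C => Re z < 0.
exists [seq z <- zs | st z]; split.
- by rewrite -sz size_filter count_size.
- by move=> z; rewrite mem_filter => /andP[].
move=> r rD; apply: (@decaying_unstable_eq0 _ [seq z <- zs | predC st z]).
- by move=> z; rewrite mem_filter /= /st -leNgt => /andP[].
- exact: decaying_mxprod.
rewrite -mulmxA -mxprod_cat (@mxprod_perm _ _ _ _ zs).
  by rewrite (mxprod_char ch) mulmx0.
by rewrite perm_filterC.
Qed.

End DecayingRows.

(** * Perturbation of normalised products of linear factors *)

Section ProductPerturbation.
Context {F : numFieldType} {m : nat}.
Implicit Types (D M : 'M[F]_m) (y : 'cV[F]_m).

Definition l1norm y : F := \sum_i `|y i 0|.
Definition l1mx D : F := \sum_i \sum_j `|D i j|.

Lemma l1norm_ge0 y : 0 <= l1norm y.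
Proof. by rewrite sumr_ge0. Qed.

Lemma l1mx_ge0 D : 0 <= l1mx D.
Proof. by rewrite sumr_ge0 // => i _; rewrite sumr_ge0. Qed.

Lemma l1norm_entry y i : `|y i 0| <= l1norm y.
Proof. by rewrite /l1norm (bigD1 i) //= lerDl sumr_ge0. Qed.

Lemma l1normD y1 y2 : l1norm (y1 + y2) <= l1norm y1 + l1norm y2.
Proof.
by rewrite -big_split /=; apply: ler_sum => i _; rewrite mxE ler_normD.
Qed.

Lemma l1normZ c y : l1norm (c *: y) = `|c| * l1norm y.
Proof. by rewrite mulr_sumr; apply: eq_bigr => i _; rewrite mxE normrM. Qed.

Lemma l1normM D y : l1norm (D *m y) <= l1mx D * l1norm y.
Proof.
rewrite mulr_suml; apply: ler_sum => i _; rewrite mxE.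
apply: le_trans (ler_norm_sum _ _ _) _; rewrite mulr_suml.
by apply: ler_sum => j _; rewrite normrM ler_wpM2l // l1norm_entry.
Qed.

Lemma l1mxD D1 D2 : l1mx (D1 + D2) <= l1mx D1 + l1mx D2.
Proof.
rewrite -big_split /=; apply: ler_sum => i _; rewrite -big_split /=.
by apply: ler_sum => j _; rewrite mxE ler_normD.
Qed.

Lemma l1mxZ c D : l1mx (c *: D) = `|c| * l1mx D.
Proof.
rewrite mulr_sumr; apply: eq_bigr => i _; rewrite mulr_sumr.
by apply: eq_bigr => j _; rewrite mxE normrM.
Qed.

(** For nonzero K this is ((1 + s K)^k - 1) / K: a further factor 1 + (M - z) / (z - w) turns a gap
    g into at most g + s (1 + K g). *)
Fixpoint product_gap (s K : F) (k : nat) : F :=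
  if k is k'.+1 then product_gap s K k' + s * (1 + K * product_gap s K k') else 0.

Lemma product_gap_ge0 s K k : 0 <= s -> 0 <= K -> 0 <= product_gap s K k.
Proof.
by move=> s0 K0; elim: k => //= k IH; rewrite addr_ge0 // mulr_ge0 // addr_ge0 // mulr_ge0.
Qed.

Lemma product_gap_mono s K k l : 0 <= s -> 0 <= K -> (k <= l)%N ->
  product_gap s K k <= product_gap s K l.
Proof.
move=> s0 K0 /subnK <-; elim: (l - k)%N => [|d IH] //.
rewrite addSn; apply: le_trans IH _ => /=; rewrite lerDl mulr_ge0 // addr_ge0 //.
by rewrite mulr_ge0 // product_gap_ge0.
Qed.

(* Each factor of the normalised product is [1 + (M - z) / (z - w)], so roots [w]
   far from [z] do no harm and no bound on them is needed. *)
Lemma mxprod_perturbation M z s K zs y :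
  0 <= K -> l1mx (M - z%:M) <= K -> 0 <= s ->
  (forall w, w \in zs -> z - w != 0 /\ `|(z - w)^-1| <= s) ->
  l1norm ((\prod_(w <- zs) (z - w))^-1 *: (mxprod M zs *m y) - y)
    <= product_gap s K (size zs) * l1norm ((M - z%:M) *m y).
Proof.
move=> K0 DK s0; elim: zs => [|w zs IH] zsP /=.
  rewrite big_nil invr1 scale1r mul1mx subrr mul0r /l1norm big1 // => i _.
  by rewrite mxE normr0.
have {}IH := IH (fun u uzs => zsP u (mem_behead (s := w :: zs) uzs)).
have [w0 ws] := zsP w (mem_head _ _).
rewrite big_cons invfM -mulmxA.
set y1 := _ *: (mxprod M zs *m y) in IH.
(* Splitting M - w as (M - z) + (z - w) isolates the previous gap y1 - y. *)
have -> : ((z - w)^-1 * (\prod_(j <- zs) (z - j))^-1) *: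
    ((M - w%:M) *m (mxprod M zs *m y)) - y =
    (y1 - y) + (z - w)^-1 *: ((M - z%:M) *m y + (M - z%:M) *m (y1 - y)).
  rewrite -mulmxDr [y + (y1 - y)]addrC subrK -scalerA scalemxAr -/y1.
  have -> : M - w%:M = (M - z%:M) + (z - w)%:M.
    by rewrite raddfB /= addrA subrK.
  rewrite mulmxDl mul_scalar_mx scalerDr scalerA mulVf // scale1r.
  by rewrite -[LHS]addrA [LHS]addrC.
apply: le_trans (l1normD _ _) _; rewrite l1normZ mulrDl; apply: lerD (IH) _.
rewrite -mulrA; apply: ler_pM ws _ => //; first exact: l1norm_ge0.
apply: le_trans (l1normD _ _) _; rewrite mulrDl mul1r lerD2l.
apply: le_trans (l1normM _ _) _; rewrite -mulrA.
by apply: ler_pM => //; rewrite ?l1mx_ge0 ?l1norm_ge0.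
Qed.

End ProductPerturbation.

(** * Leader-follower networks *)

Section Necessity.
Variable R : realType.
Local Notation C := R[i].
Local Notation Re := (@complex.Re R).

Variables (n nc q : nat) (A : 'M[R]_n) (B : 'cV[R]_n) (C0 : 'rV[R]_n).
Variables (Ac : 'M[R]_nc) (Bc : 'cV[R]_nc) (Ec : 'M[R]_(nc, q)).
Variables (Fc : 'rV[R]_nc) (G1 : 'M[R]_1) (G2 : 'rV[R]_q) (Hc : 'M[R]_(q, nc)).

Hypothesis synchronizing : forall (N : nat) (a : 'M[R]_N),
  adjacency a -> has_spanning_tree a ->
  forall (x : 'I_N -> R -> 'cV[R]_n) (xc : 'I_N -> R -> 'cV[R]_nc),
    closed_loop A B C0 Ac Bc Ec Fc G1 G2 Hc a x xc ->
    forall i j : 'I_N, tends_to_zero (fun t => x i t - x j t).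

(* With a leader at rest and one follower coupled with weight [w], the follower
   evolves by [M0 + w M1]. *)
Let M0 : 'M[R]_(n + nc) := block_mx A (B *m Fc) 0 Ac.
Let M1 : 'M[R]_(n + nc) :=
  block_mx (B *m G1 *m C0) (B *m G2 *m Hc) (Bc *m C0) (Ec *m Hc).

Lemma follower_decay (w : R) (X : R -> 'cV[R]_(n + nc)) : 0 < w ->
  has_deriv X (fun t => (M0 + w *: M1) *m X t) ->
  tends_to_zero (fun t => usubmx (X t)).
Proof.
move=> w0 Xd.
pose a : 'M[R]_2 := \matrix_(i, j) (if (i == ord_max) && (j == ord0) then w else 0).
have adj : adjacency a.
  split=> [i j|i]; rewrite mxE; first by case: ifP => // _; rewrite ltW.
  by case: ifP => // /andP[/eqP -> /eqP/(congr1 val)].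
have tree : has_spanning_tree a.
  exists ord0 => i; have [->|i0] := eqVneq i ord0; first exact: connect0.
  apply: connect1; rewrite /edge mxE eqxx andbT ifT //.
  by apply/eqP/val_inj; case: i i0 => -[|[|]].
(* The leader has no incoming edge, so its Laplacian row is zero and rest is a solution; the
   synchronization error is then the follower's own state. *)
pose x (i : 'I_2) t : 'cV[R]_n := if i == ord0 then 0 else usubmx (X t).
pose xc (i : 'I_2) t : 'cV[R]_nc := if i == ord0 then 0 else dsubmx (X t).
have L0 : laplacian a ord0 ord_max = 0 by rewrite !mxE oppr0.
have L1 : laplacian a ord_max ord_max = w.
  by rewrite mxE eqxx big_ord_recl big_ord1 !mxE eqxx /= addr0.
have sumx m (P : 'M[R]_(m, n)) i t : \sum_(j < 2) laplacian a i j *: (P *m x j t) =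
    laplacian a i ord_max *: (P *m usubmx (X t)).
  rewrite big_ord_recr big_ord1 /= /x /= mulmx0 scaler0 add0r.
  by congr (laplacian a i _ *: _); apply: val_inj.
have sumxc m (P : 'M[R]_(m, nc)) i t :
    \sum_(j < 2) laplacian a i j *: (P *m xc j t) =
    laplacian a i ord_max *: (P *m dsubmx (X t)).
  rewrite big_ord_recr big_ord1 /= /xc /= mulmx0 scaler0 add0r.
  by congr (laplacian a i _ *: _); apply: val_inj.
have cl : closed_loop A B C0 Ac Bc Ec Fc G1 G2 Hc a x xc.
  move=> i /=; have [->|i0] := eqVneq i ord0.
    by split=> t k l; rewrite sumx sumxc L0 !scale0r /x /xc eqxx !(mulmx0, addr0) mxE;
      exact: is_derive_cst.
  have -> : i = ord_max by apply: val_inj; case: i i0 => -[|[|]].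
  have ME t : (M0 + w *: M1) *m X t = col_mx
      (A *m usubmx (X t) + B *m (Fc *m dsubmx (X t) + G1 *m (w *: (C0 *m usubmx (X t)))
         + G2 *m (w *: (Hc *m dsubmx (X t)))))
      (Ac *m dsubmx (X t) + Bc *m (w *: (C0 *m usubmx (X t)))
         + Ec *m (w *: (Hc *m dsubmx (X t)))).
    rewrite -{1}[X t]vsubmxK scale_block_mx add_block_mx mul_block_col.
    move: (usubmx (X t)) (dsubmx (X t)) => u v; congr col_mx.
      rewrite !mulmxDl !mulmxDr -!scalemxAr -!scalemxAl !mulmxA -!addrA.
      by congr (_ + _); rewrite addrCA.
    rewrite add0r !mulmxDl -!scalemxAr -!scalemxAl !mulmxA.
    by rewrite addrCA addrA.
  split=> t k l; rewrite sumx sumxc L1 /x /xc /=.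
    have := Xd t (lshift nc k) l; rewrite ME col_mxEu.
    by congr is_derive; apply/funext => s; rewrite mxE.
  have := Xd t (rshift n k) l; rewrite ME col_mxEd.
  by congr is_derive; apply/funext => s; rewrite mxE.
have := synchronizing adj tree cl ord_max ord0 => h k l.
by apply: cvg0_ext (h k l) => t; rewrite /x /= subr0.
Qed.

(** The roots depend on [w], but their number is bounded independently of it, which is what the
    limit of small [w] requires. *)
Lemma follower_annihilator (w : R) : 0 < w -> exists zs : seq C,
  [/\ (size zs <= n + nc)%N, forall z, z \in zs -> Re z < 0
    & forall r : 'rV[C]_n,
        row_mx r 0 *m mxprod (mxC M0 + (w%:C)%C *: mxC M1) zs = 0].
Proof.
move=> w0; have [zs [sz zs0 zsP]] := decaying_stable_annihilator (M0 + w *: M1).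
exists zs; split=> // r; rewrite -map_mxZ -map_mxD; apply: zsP => x xd k l.
have /ctends0mxC/(ctends0mxMl r) h := follower_decay w0 xd.
apply: eq_ctends0 (h k l) => t; rewrite -{1}[x t]vsubmxK map_col_mx mul_row_col.
by rewrite mul0mx addr0.
Qed.

Lemma prod_stable_neq0 (z : C) zs : 0 <= Re z ->
  (forall w, w \in zs -> Re w < 0) -> \prod_(w <- zs) (z - w) != 0.
Proof.
move=> z0 zs0; rewrite prodf_seq_neq0; apply/allP => w /zs0 w0 /=.
by apply: contraTneq w0 => /subr0_eq <-; rewrite -leNgt.
Qed.

(** If r B = 0, then (r, 0) is a left eigenvector of the follower matrix for z, and the annihilating
    product acts on it by a nonzero scalar. *)
Lemma synchronizing_pbh_stabilizable : pbh_stabilizable A B.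
Proof.
move=> z r z0 rA rB; have [zs [_ zs0 zsP]] := follower_annihilator ltr01.
have := zsP r; rewrite (@mxprod_eig_row _ _ _ _ z).
  move/eqP; rewrite scaler_eq0 (negbTE (prod_stable_neq0 z0 zs0)) /=.
  by rewrite -row_mx0 => /eqP/eq_row_mx[].
rewrite scale1r /M0 /M1 !map_block_mx add_block_mx mul_row_block !mul0mx !addr0.
rewrite !mulmxDr !map_mxM !mulmxA rB !mul0mx !addr0 scale_row_mx scaler0.
by rewrite -rA.
Qed.

Lemma follower_eigencol (w : R) z (v : 'cV[C]_n) : mxC A *m v = z *: v ->
  (mxC M0 + (w%:C)%C *: mxC M1 - z%:M) *m col_mx v 0 =
  (w%:C)%C *: (mxC M1 *m col_mx v (0 : 'cV_nc)).
Proof.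
move=> Av; rewrite mulmxBl mulmxDl -scalemxAl mul_scalar_mx /M0 map_block_mx.
rewrite mul_block_col !mulmx0 !addr0 Av raddf0 mul0mx scale_col_mx scaler0.
by rewrite addrC addKr.
Qed.

(** Dually, an unobservable right eigenvector v of [A] makes (v, 0) a right eigenvector of the
    follower matrix; pairing with coordinate rows gives v = 0. *)
Lemma synchronizing_pbh_detectable : pbh_stabilizable A^T C0^T.
Proof.
move=> z r z0 rA rC; have [zs [_ zs0 zsP]] := follower_annihilator ltr01.
have Av : mxC A *m r^T = z *: r^T.
  by rewrite -[LHS]trmxK trmx_mul trmxK map_trmx [_ *m _]rA linearZ.
have Cv : mxC C0 *m r^T = 0.
  by rewrite -[LHS]trmxK trmx_mul trmxK map_trmx rC trmx0.
have Mv : (mxC M0 + (1%:C)%C *: mxC M1) *m col_mx r^T 0 = z *: col_mx r^T 0.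
  apply/eqP; rewrite -subr_eq0 -[z *: _]mul_scalar_mx -mulmxBl follower_eigencol //.
  rewrite /M1 map_block_mx mul_block_col !mulmx0 !addr0 !map_mxM -!mulmxA Cv.
  by rewrite !mulmx0 col_mx0 scaler0.
apply/matrixP => k j; rewrite ord1 [RHS]mxE.
have := congr1 (fun Z => (Z *m col_mx r^T (0 : 'cV_nc)) 0 0) (zsP (delta_mx 0 j)).
rewrite mul0mx -mulmxA (mxprod_eig_col _ Mv) -scalemxAr mul_row_col mul0mx addr0.
rewrite -rowE 3!mxE [RHS]mxE => /eqP.
by rewrite mulf_eq0 (negbTE (prod_stable_neq0 z0 zs0)) => /eqP.
Qed.

Lemma le_small_multiples_eq0 (x y : R) : 0 <= x -> 0 <= y ->
  (forall w, 0 < w -> w <= 1 -> x <= y * w) -> x = 0.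
Proof.
move=> x0 y0 h; apply/eqP; apply: contraT => xn0.
have xp : 0 < x by rewrite lt_neqAle eq_sym xn0.
have d0 : 0 < 2 * y + x by lra.
(* This weight is at most 1, and it makes the bound y w at most x / 2. *)
have := h (x / (2 * y + x)).
rewrite divr_gt0 // ler_pdivrMr // mul1r => /(_ isT).
rewrite lerDr mulr_ge0 // => /(_ isT).
by rewrite mulrA ler_pdivlMr // mulrC ler_pM2r //; lra.
Qed.

(* An unstable mode of [A] survives, up to an error [O(w)], as [w] tends to [0]. *)
Lemma synchronizing_closed_lhp : eig_closed_lhp A.
Proof.
move=> z; rewrite -eigenvalue_tr => /eigenvalueP[r rA r0].
rewrite leNgt; apply: contra r0 => z0; apply/eqP.
have Av : mxC A *m r^T = z *: r^T.
  by rewrite -[LHS]trmxK trmx_mul trmxK [_ *m _]rA linearZ.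
(* Roots w' with Re w' < 0 satisfy |z - w'| >= Re z, so [s] bounds all the inverses whatever the
   weight; [K] likewise bounds M - z for all weights up to 1. *)
pose s : C := ((Re z)^-1%:C)%C.
have s0 : 0 <= s by rewrite ler0c invr_ge0 ltW.
pose K := l1mx (mxC M0 - z%:M) + l1mx (mxC M1).
have K0 : 0 <= K by rewrite addr_ge0 // l1mx_ge0.
pose Q := product_gap s K (n + nc) * l1norm (mxC M1 *m col_mx r^T (0 : 'cV_nc)).
have Q0 : 0 <= Q by rewrite mulr_ge0 // ?product_gap_ge0 // l1norm_ge0.
have realC (x : C) : 0 <= x -> ((Re x)%:C)%C = x.
  by move=> x0; rewrite RRe_real // ger0_real.
have key k (w : R) : 0 < w -> w <= 1 -> `|r 0 k| <= Q * (w%:C)%C.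
  move=> w0 w1; have [zs [sz zs0 zsP]] := follower_annihilator w0.
  set M := (mxC M0 + _) in zsP.
  have wC0 : 0 <= (w%:C)%C by rewrite ler0c ltW.
  have DK : l1mx (M - z%:M) <= K.
    rewrite /M addrAC; apply: le_trans (l1mxD _ _) _; rewrite lerD2l l1mxZ.
    by rewrite ger0_norm // ler_piMl ?l1mx_ge0 // -[1]/((1%:C)%C) lecR.
  have zsN w' : w' \in zs -> z - w' != 0 /\ `|(z - w')^-1| <= s.
    move=> /zs0 w'0; have wz : 0 < Re (z - w').
      by case: (z) (w') z0 w'0 => ? ? [? ?] /=; lra.
    have zw : z - w' != 0 by apply: contraTneq wz => ->; rewrite ltxx.
    split=> //; rewrite normfV /s fmorphV lef_pV2 ?posrE ?normr_gt0 ?ltcR //.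
    apply: le_trans (normc_ge_Re _); rewrite lecR ger0_norm; last exact: ltW.
    by case: (z) (w') z0 w'0 => ? ? [? ?] /=; lra.
  have := mxprod_perturbation (col_mx r^T 0) K0 DK s0 zsN.
  set y := _ *: (mxprod M zs *m _) => yle.
  (* The annihilator kills the agent coordinates of the product, so the gap at coordinate [k] is
     exactly the modulus of [r 0 k]. *)
  have yk : y (lshift nc k) 0 = 0.
    have := congr1 (fun Z => (Z *m col_mx r^T (0 : 'cV_nc)) 0 0) (zsP (delta_mx 0 k)).
    have -> : row_mx (delta_mx 0 k) 0 = delta_mx 0 (lshift nc k) :> 'rV[C]_(n + nc).
      apply/matrixP => i j; rewrite !mxE; case: split_ordP => j' ->.
        by rewrite mxE (inj_eq (@lshift_inj _ _)).
      by rewrite mxE eq_rlshift andbF.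
    rewrite mul0mx -mulmxA -rowE [LHS]mxE [RHS]mxE => h.
    by rewrite /y [LHS]mxE h mulr0.
  have -> : `|r 0 k| = `|(y - col_mx r^T 0) (lshift nc k) 0|.
    by rewrite [(y - _) _ _]mxE yk add0r mxE normrN col_mxEu mxE.
  apply: le_trans (l1norm_entry _ _) _; apply: le_trans yle _.
  rewrite follower_eigencol // l1normZ ger0_norm // /Q -mulrA [_ * (w%:C)%C]mulrC.
  apply: ler_wpM2r; first by rewrite mulr_ge0 // l1norm_ge0.
  exact: product_gap_mono.
apply/matrixP => i k; rewrite ord1 [RHS]mxE; apply/eqP; rewrite -normr_eq0.
rewrite -(realC `|r 0 k|) //.
rewrite (@le_small_multiples_eq0 (Re `|r 0 k|) (Re Q)) //.
- by rewrite -ler0c realC.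
- by rewrite -ler0c realC.
by move=> w w0 w1; rewrite -lecR rmorphM /= !realC //; exact: key.
Qed.

End Necessity.

Theorem theorem5 (R : realType) (n : nat)
  (A : 'M[R]_n) (B : 'M[R]_(n, 1)) (C : 'M[R]_(1, n)) :
  (exists (nc q : nat) (Ac : 'M[R]_nc) (Bc : 'M[R]_(nc, 1)) (Ec : 'M[R]_(nc, q))
          (Fc : 'M[R]_(1, nc)) (G1 : 'M[R]_1) (G2 : 'M[R]_(1, q))
          (Hc : 'M[R]_(q, nc)),
     forall (N : nat) (a : 'M[R]_N),
       adjacency a -> has_spanning_tree a ->
       forall (x : 'I_N -> R -> 'cV[R]_n) (xc : 'I_N -> R -> 'cV[R]_nc),
         closed_loop A B C Ac Bc Ec Fc G1 G2 Hc a x xc ->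
         forall i j : 'I_N, tends_to_zero (fun t => x i t - x j t))
  <->
  (hurwitz A \/ (stabilizable A B /\ detectable C A /\ eig_closed_lhp A)).
Proof.
split=> [[nc [q [Ac [Bc [Ec [Fc [G1 [G2 [Hc sync]]]]]]]]]|].
  right; split; first exact/stabilizable_of_pbh/synchronizing_pbh_stabilizable/sync.
  split; last exact: synchronizing_closed_lhp sync.
  apply/detectable_of_stabilizable_tr/stabilizable_of_pbh.
  exact: synchronizing_pbh_detectable sync.
move=> [hA|[sAB [dCA hA]]]; last exact: protocol_exists.
(* For Hurwitz [A] the same protocol is used, with zero gains as witnesses. *)
apply: protocol_exists.
- by exists 0; rewrite mulmx0 addr0.
- by exists 0; rewrite mul0mx addr0.
by move=> z /hA /ltW.
Qed.
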